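(* (i) If $\xi$ and $\eta$ are independent random variables, $\xi$ having a chi-square distribution and $\eta$ having a normal distribution, then the product $\xi\eta$ is M-indet. (ii) If $\xi$ and $\eta$ are independent random variables, $\xi$ having an inverse Gaussian distribution and $\eta$ having a normal distribution, then the product $\xi\eta$ is M-indet.
   Context: The inverse Gaussian distribution $IG(\mu,\lambda)$, $\mu,\lambda>0$, has density $f(x)=\left(\frac{\lambda}{2\pi x^3}\right)^{1/2}\exp\left[-\frac{\lambda(x-\mu)^2}{2\mu^2x}\right]$ for $x>0$ (and $f(x)=0$ for $x\le 0$). Normal distributions are non-degenerate (positive variance). A random variable $X$ with distribution function $F$ and moments $m_k=\mathbf{E}[X^k]$ (all finite) is called moment determinate (M-det) if $F$ is the only distribution having the moment sequence $\{m_k\}_{k=1}^\infty$; otherwise it is called moment indeterminate (M-indet). *)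

(* Defs.v *)
From HB Require Import structures.
From mathcomp Require Export all_boot all_order all_algebra.
From mathcomp Require Export all_classical all_reals all_analysis.
(* provides the ring structure of measurable functions; not part of all_analysis *)
From mathcomp Require Export measurable_realfun.

Set Implicit Arguments.
Unset Strict Implicit.
Unset Printing Implicit Defensive.

Import Order.TTheory GRing.Theory Num.Theory.
Import numFieldNormedType.Exports.

Local Open Scope classical_set_scope.
Local Open Scope ring_scope.

(* Restricted to Borel sets: a measure is a function on all sets, with arbitrary
   values at the non-measurable ones, so [distribution P X = Q] is too strong. *)
Definition has_law (d : measure_display) (T : measurableType d) (R : realType)
    (P : probability T R) (X : {RV P >-> R}) (Q : set R -> \bar R) : Prop :=
  forall A : set R, measurable A -> distribution P X A = Q A.
Arguments has_law {d T R} P X Q.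

Definition independent_RV (d : measure_display) (T : measurableType d)
    (R : realType) (P : probability T R) (X Y : {RV P >-> R}) : Prop :=
  forall A B : set R, measurable A -> measurable B ->
    P (X @^-1` A `&` Y @^-1` B) = (P (X @^-1` A) * P (Y @^-1` B))%E.
Arguments independent_RV {d T R} P X Y.

Definition Gamma (R : realType) (a : R) : R :=
  \int[lebesgue_measure]_(t in `]0, +oo[) (t `^ (a - 1) * expR (- t)).

(* [k] is the number of degrees of freedom; meant for [0 < k]. *)
Definition chi_square_pdf (R : realType) (k : nat) (x : R) : R :=
  if 0 < x then
    x `^ (k%:R / 2 - 1) * expR (- x / 2) / (2 `^ (k%:R / 2) * Gamma (k%:R / 2))
  else 0.

Definition chi_square_prob (R : realType) (k : nat) : set R -> \bar R :=
  fun A => (\int[lebesgue_measure]_(x in A) (chi_square_pdf k x)%:E)%E.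

(* Meant for [0 < mu] and [0 < lambda]. *)
Definition inverse_gaussian_pdf (R : realType) (mu lambda x : R) : R :=
  if 0 < x then
    Num.sqrt (lambda / (2 * pi * x ^+ 3)) *
    expR (- (lambda * (x - mu) ^+ 2 / (2 * mu ^+ 2 * x)))
  else 0.

Definition inverse_gaussian_prob (R : realType) (mu lambda : R) :
    set R -> \bar R :=
  fun A =>
    (\int[lebesgue_measure]_(x in A) (inverse_gaussian_pdf mu lambda x)%:E)%E.

Definition finite_moments (d : measure_display) (T : measurableType d)
    (R : realType) (P : probability T R) (X : T -> R) : Prop :=
  forall k : nat, P.-integrable [set: T] (fun w => (X w ^+ k)%:E).
Arguments finite_moments {d T R} P X.

(* [nu] has finite moments, and they are those of [X]. Order 0 adds nothing. *)
Definition has_moments_of (d : measure_display) (T : measurableType d)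
    (R : realType) (P : probability T R) (X : {RV P >-> R})
    (nu : probability R R) : Prop :=
  finite_moments nu id /\
  forall k : nat, ('E_nu[fun x : R => (x ^+ k)%R] = 'E_P[fun w => (X w ^+ k)%R])%E.
Arguments has_moments_of {d T R} P X nu.

Definition M_det (d : measure_display) (T : measurableType d) (R : realType)
    (P : probability T R) (X : {RV P >-> R}) : Prop :=
  finite_moments P X /\
  forall nu : probability R R, has_moments_of P X nu -> has_law P X nu.
Arguments M_det {d T R} P X.

(* Both notions are reserved for variables all of whose moments are finite. *)
Definition M_indet (d : measure_display) (T : measurableType d) (R : realType)
    (P : probability T R) (X : {RV P >-> R}) : Prop :=
  finite_moments P X /\ ~ M_det P X.
Arguments M_indet {d T R} P X.

(* Main.v *)
From HB Require Import structures.
Require Import Defs.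
From mathcomp Require Import ring lra.

(** Why the products are indeterminate.  A law with density f is indeterminate
    as soon as some bounded function h, not zero f-almost everywhere, is
    orthogonal in L^2(f) to all polynomials: then (1 + h) f, with h scaled to
    |h| <= 1, is another law with the same moments.  The density of xi * eta is
    an unpleasant integral, but h may be chosen as a function of the pair
    (xi, eta): it is enough that E[h (xi eta)^k] = 0 for all k, while
    E[h |xi eta|] is not 0, and the second law is that of xi * eta under the
    probability (1 + h) P.  This is [perturbation_M_indet].

    Both laws of xi have a density proportional to
    x^(s-1) exp(-(a x + b/x)) on x > 0, that is, they are generalized inverse
    Gaussian: s = k/2, a = 1/2, b = 0 for the chi-square law, and s = -1/2,
    a = lambda/(2 mu^2), b = lambda/2 for the inverse Gaussian law.  Let z be
    the complex number exp(i th), with 0 < th < pi/2.  Rotating the half-line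
    of integration by the angle th gives, for a' > 0, b' >= 0 and all n,

      int_0^oo x^(s+n-1) exp(-(z a' x + b'/(z x))) dx
        = z^-(s+n) int_0^oo x^(s+n-1) exp(-(a' x + b'/x)) dx

    (with s > 0 if b' = 0), and similarly, for the Gaussian weight,

      int |y|^n exp(-z c y^2) dy = z^-((n+1)/2) int |y|^n exp(-c y^2) dy.

    When a' = a / cos th and b' = b / cos th, the modulus of the first integrand
    is exactly x^n times the density of xi up to a constant; when
    c = 1 / (sigma^2 cos th), the modulus exp(-y^2/sigma^2) of the second weight
    is bounded by a multiple of the density of eta, whatever its mean m.  Hence
    the product of the two weights, divided by the joint density, has the form
    (bounded positive function) * exp(i phase), and h is its real part after
    multiplication by a constant of modulus one.

    The moment of order n then carries the phase
    -(s + n) th - (n + 1) th / 2, which decreases by 3 th / 2 when n increases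
    by one.  For th = pi/3 this step is a right angle, so the constant can be
    chosen in such a way that E[h |xi eta|^n] is a positive multiple of
    sin (n pi / 2).  That is 0 for all even n, and not 0 for n = 1; the signed
    moments of odd order are 0 because the weight is even in y.

    Complex numbers and contour integrals are avoided: the real form
    [integral_rotation] of the rotation is proved by checking that the angle
    derivative of the integrand, after multiplication by the expected phase
    factor, is a total derivative in x ([is_derive_rotated] and
    [is_derive_angle]), so that the integral does not depend on the angle. *)

Set Implicit Arguments.
Unset Strict Implicit.
Unset Printing Implicit Defensive.

Import Order.TTheory GRing.Theory Num.Theory.
Import numFieldNormedType.Exports.

Local Open Scope classical_set_scope.
Local Open Scope ring_scope.

(** * Measures with a density *)

Lemma density_probability d (T : measurableType d) (R : realType)
    (P : probability T R) (w : T -> R) :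
  measurable_fun [set: T] w -> (forall x, 0 <= w x) ->
  (\int[P]_x (w x)%:E = 1)%E ->
  exists Q : probability T R,
    forall A, measurable A -> Q A = (\int[P]_(x in A) (w x)%:E)%E.
Proof.
move=> mw w0 w1.
pose q A := (\int[P]_(x in A) (w x)%:E)%E.
have q_set0 : q set0 = 0%E by exact: integral_set0.
have q_ge0 A : (0 <= q A)%E by apply: integral_ge0 => x _; rewrite lee_fin.
have mwE : measurable_fun [set: T] (EFin \o w) by exact/measurable_EFinP.
have q_add : semi_sigma_additive q.
  move=> A mA tA mUA; rewrite /q integral_bigcup//; last first.
    apply: (integrableS measurableT) => //; apply/integrableP; split => //.
    by under eq_integral do rewrite /= ger0_norm//; rewrite w1 ltry.
  by apply: is_cvg_ereal_nneg_natsum_cond => n _ _; exact: q_ge0.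
pose m : {measure set T -> \bar R} :=
  HB.pack q (isMeasure.Build _ _ _ q q_set0 q_ge0 q_add).
have m1 : m [set: T] = 1%E by exact: w1.
pose Q : probability T R :=
  HB.pack q m (Measure_isProbability.Build _ _ _ m m1).
by exists Q.
Qed.

Section density.
Context d (T : measurableType d) (R : realType).
Variables (mu : {sigma_finite_measure set T -> \bar R})
          (nu : {finite_measure set T -> \bar R}) (w : T -> R).
Hypothesis mw : measurable_fun [set: T] w.
Hypothesis w0 : forall x, 0 <= w x.
Hypothesis nuE :
  forall A, measurable A -> nu A = (\int[mu]_(x in A) (w x)%:E)%E.

(** The Radon-Nikodym derivative of nu agrees with w almost everywhere, which
    reduces the formula to the change of variables for that derivative. *)
Lemma ge0_integral_density (f : T -> \bar R) :
  measurable_fun [set: T] f -> (forall x, 0 <= f x)%E ->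
  (\int[nu]_x f x = \int[mu]_x (f x * (w x)%:E))%E.
Proof.
move=> mf f0.
have numu : nu `<< mu.
  apply/null_content_dominatesP => A mA muA0.
  rewrite nuE// (null_set_integral mA _ muA0)//.
  exact/measurable_EFinP/measurable_funTS.
rewrite -(Radon_Nikodym_SigmaFinite.change_of_variables numu)//.
have fi := Radon_Nikodym_SigmaFinite.f_integrable numu.
have mRN := measurable_int _ fi.
apply: ae_eq_integral => //.
- exact: emeasurable_funM.
- by apply: emeasurable_funM => //; exact/measurable_EFinP.
- apply: ae_eqe_mul2l; apply: integral_ae_eq => //.
  + exact/measurable_EFinP.
  + by move=> A _ mA; rewrite -Radon_Nikodym_SigmaFinite.f_integral// nuE.
Qed.

Variable f : T -> R.
Hypothesis mf : measurable_fun [set: T] f.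

Lemma integral_density :
  (\int[nu]_x (f x)%:E = \int[mu]_x (f x * w x)%:E)%E.
Proof.
rewrite [LHS]integralE [RHS]integralE.
have mfE : measurable_fun [set: T] (EFin \o f) by exact/measurable_EFinP.
rewrite ge0_integral_density; [|exact: measurable_funepos|by []].
rewrite ge0_integral_density; [|exact: measurable_funeneg|by []].
congr (_ - _)%E; apply: eq_integral => x _.
- by rewrite !funeposE /= -!EFin_max -EFinM maxr_pMl// mul0r.
- by rewrite !funenegE /= -!EFin_max -EFinM maxr_pMl// mul0r mulNr.
Qed.

Lemma integrable_density :
  mu.-integrable [set: T] (fun x => (f x * w x)%:E) ->
  nu.-integrable [set: T] (EFin \o f).
Proof.
move=> fwi; apply/integrableP; split; first exact/measurable_EFinP.
rewrite ge0_integral_density//; last first.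
  by apply/measurableT_comp => //; exact/measurable_EFinP.
move: fwi => /integrableP[_]; apply: le_lt_trans.
rewrite le_eqVlt; apply/orP; left; apply/eqP.
by apply: eq_integral => x _; rewrite /= normrM (ger0_norm (w0 _)) EFinM.
Qed.

End density.

Section laws_with_density.
Context d (T : measurableType d) (R : realType) (P : probability T R).
Notation mu := (@lebesgue_measure R).
Local Notation pos := (`]0%R, +oo[%classic : set R).
Variables (X : {RV P >-> R}) (w : R -> R).
Hypothesis mw : measurable_fun [set: R] w.
Hypothesis w0 : forall x, 0 <= w x.
Hypothesis lawX : has_law P X (fun A => \int[mu]_(x in A) (w x)%:E)%E.
Variable F : R -> R.
Hypothesis mF : measurable_fun [set: R] F.

(* The same variable, seen with values in the measurable space of mu. *)
Let mX : measurable_fun [set: T] (X : T -> measurableTypeR R).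
Proof. exact: (measurable_funPT X). Qed.

Let X' : {RV P >-> measurableTypeR R} :=
  HB.pack (X : T -> measurableTypeR R) (isMeasurableFun.Build _ _ _ _ _ mX).

Let lawX' A : measurable A ->
  distribution P X' A = (\int[mu]_(x in A) (w x)%:E)%E.
Proof. exact: lawX. Qed.

Let mFE : measurable_fun [set: measurableTypeR R] (EFin \o F).
Proof. exact/measurable_EFinP. Qed.

Lemma law_density_integrable :
  mu.-integrable [set: R] (EFin \o (fun x => F x * w x)) ->
  P.-integrable [set: T] (EFin \o (F \o X)).
Proof.
move=> Fwi.
have := @integrable_density _ _ R mu (distribution P X') w mw w0 lawX' F mF Fwi.
move/integrableP => [_ Foo]; apply/integrableP; split.
  exact: (measurableT_comp mFE mX).
have mabs : measurable_fun [set: measurableTypeR R] (abse \o (EFin \o F)).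
  exact: measurableT_comp.
by rewrite -(ge0_integral_distribution X' mabs (fun y => abse_ge0 _)).
Qed.

Lemma law_density_integral :
  mu.-integrable [set: R] (EFin \o (fun x => F x * w x)) ->
  (\int[P]_t (F (X t))%:E = (\int[mu]_x (F x * w x))%:E)%E.
Proof.
move=> Fwi; rewrite -(integral_distribution (X := X') mFE); last first.
  exact: law_density_integrable.
have := @integral_density _ _ R mu (distribution P X') w mw w0 lawX' F mF.
by move=> ->; rewrite /Rintegral fineK//; exact: integrable_fin_num Fwi.
Qed.

End laws_with_density.

(** * Perturbing a law without changing its moments *)

Lemma integrable_mul_le1 d (T : measurableType d) (R : realType)
    (P : probability T R) (f g : T -> R) :
  measurable_fun [set: T] g -> (forall w, `|g w| <= 1) ->
  P.-integrable [set: T] (EFin \o f) ->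
  P.-integrable [set: T] (EFin \o (fun w => f w * g w)).
Proof.
move=> mg g1 fi; apply: (le_integrable _ _ _ fi) => //.
  apply/measurable_EFinP/measurable_funM => //.
  exact/measurable_EFinP/(measurable_int _ fi).
by move=> w _; rewrite lee_fin normrM ler_piMr.
Qed.

Section stieltjes_class.
Context d (T : measurableType d) (R : realType).
Variables (P : probability T R) (X : {RV P >-> R}) (h : T -> R).
Hypothesis mh : measurable_fun [set: T] h.
Hypothesis h1 : forall w, `|h w| <= 1.
Hypothesis Xfin : finite_moments P X.

Let h1D_ge0 w : 0 <= 1 + h w.
Proof. by have := h1 w; rewrite ler_norml => /andP[]; lra. Qed.

Let mh1D : measurable_fun [set: T] (fun w => 1 + h w).
Proof. exact: measurable_funD. Qed.

Let mX : measurable_fun [set: T] X. Proof. exact: measurable_funPT. Qed.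

Let integrableMh (f : T -> R) : P.-integrable [set: T] (EFin \o f) ->
  P.-integrable [set: T] (fun w => (f w * h w)%:E).
Proof. exact: integrable_mul_le1. Qed.

Let integrableMh1D (f : T -> R) : P.-integrable [set: T] (EFin \o f) ->
  P.-integrable [set: T] (fun w => (f w * (1 + h w))%:E).
Proof.
move=> fi; under eq_fun do rewrite mulrDr mulr1 EFinD.
by apply: integrableD => //; exact: integrableMh.
Qed.

Let integralMh1D (f : T -> R) : P.-integrable [set: T] (EFin \o f) ->
  (\int[P]_w (f w * (1 + h w))%:E =
   \int[P]_w (f w)%:E + \int[P]_w (f w * h w)%:E)%E.
Proof.
move=> fi; under eq_integral do rewrite mulrDr mulr1 EFinD.
by rewrite integralD//; exact: integrableMh.
Qed.

(** The second solution of the moment problem is the law of X under the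
    probability of density 1 + h.  It has the moments of X, but a different
    absolute moment of order 1. *)
Lemma perturbation_M_indet :
  (forall k, \int[P]_w (X w ^+ k * h w)%:E = 0)%E ->
  (\int[P]_w (`|X w| * h w)%:E != 0)%E ->
  M_indet P X.
Proof.
move=> Xh0 Xh_neq0; split => // -[_ Xdet].
have mass1 : (\int[P]_w (1 + h w)%:E = 1)%E.
  have := integralMh1D (Xfin 0).
  under eq_integral do rewrite expr0 mul1r.
  move=> ->; rewrite Xh0 adde0.
  under eq_integral do rewrite expr0.
  rewrite integral_cst// mul1e.
  exact: (probability_setT P).
have [Q QE] := density_probability mh1D h1D_ge0 mass1.
pose nu : probability R R := distribution Q X.
have nu_integrable (f : R -> R) : measurable_fun [set: R] f ->
    P.-integrable [set: T] (EFin \o (f \o X)) ->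
    nu.-integrable [set: R] (EFin \o f).
  move=> mf fi; apply: integrable_pushforward => //.
    exact/measurable_EFinP.
  rewrite preimage_setT.
  apply: (integrable_density mh1D h1D_ge0 QE (measurableT_comp mf mX)).
  exact: integrableMh1D.
have nu_integral (f : R -> R) : measurable_fun [set: R] f ->
    P.-integrable [set: T] (EFin \o (f \o X)) ->
    (\int[nu]_x (f x)%:E =
     \int[P]_w (f (X w))%:E + \int[P]_w (f (X w) * h w)%:E)%E.
  move=> mf fi; rewrite integral_pushforward//; last 2 first.
  - exact/measurable_EFinP.
  - rewrite preimage_setT.
    apply: (integrable_density mh1D h1D_ge0 QE (measurableT_comp mf mX)).
    exact: integrableMh1D.
  rewrite preimage_setT -(integralMh1D fi).
  exact: (integral_density mh1D h1D_ge0 QE (measurableT_comp mf mX)).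
have mexp k : measurable_fun [set: R] (fun x : R => x ^+ k).
  exact: measurable_funX.
have same_law : has_law P X nu.
  apply: Xdet; split=> [k|k]; first exact: nu_integrable (mexp k) (Xfin k).
  by rewrite unlock nu_integral//; [rewrite Xh0 adde0|exact: Xfin].
have mabs : measurable_fun [set: R] (fun x : R => `|x|).
  exact: normr_measurable.
have absXi : P.-integrable [set: T] (EFin \o ((fun x : R => `|x|) \o X)).
  apply: (@integrable_norm _ _ _ _ _ X).
  by have := Xfin 1; under eq_fun do rewrite expr1.
have := nu_integral _ mabs absXi.
have -> : (\int[nu]_x (`|x|)%:E = \int[P]_w (`|X w|)%:E)%E.
  transitivity (\int[distribution P X]_x (`|x|)%:E)%E.
    by apply: eq_measure_integral => A mA _; exact/esym/same_law.
  by rewrite integral_distribution//; exact/measurable_EFinP.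
have absXfin := integrable_fin_num measurableT absXi.
have absXhfin := integrable_fin_num measurableT (integrableMh absXi).
move: Xh_neq0.
rewrite /= in absXfin absXhfin *.
rewrite -(fineK absXfin) -(fineK absXhfin) -EFinD => /eqP h0 [] /eqP.
by rewrite addrC -subr_eq subrr eq_sym => /eqP h00; apply: h0; rewrite h00.
Qed.

End stieltjes_class.

(** * Products of independent variables *)

Section independent_product.
Context d (T : measurableType d) (R : realType) (P : probability T R).
Variables xi eta : {RV P >-> R}.
Hypothesis xi_eta : independent_RV P xi eta.
Variables F G : R -> R.
Hypotheses (mF : measurable_fun [set: R] F) (mG : measurable_fun [set: R] G).
Hypotheses (Fi : P.-integrable [set: T] (EFin \o (F \o xi)))
           (Gi : P.-integrable [set: T] (EFin \o (G \o eta))).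

Let pair w := (xi w, eta w).

Let mpair : measurable_fun [set: T] pair.
Proof. by apply: measurable_fun_pair; exact: measurable_funPT. Qed.

Let joint : {mfun T >-> (R * R)%type} :=
  HB.pack pair (isMeasurableFun.Build _ _ _ _ pair mpair).

Let P_xi : probability R R := distribution P xi.
Let P_eta : probability R R := distribution P eta.

(* Independence says that the joint law and the product of the marginals agree
   on rectangles, hence everywhere. *)
Let jointE A : measurable A -> (P_xi \x P_eta)%E A = distribution P joint A.
Proof.
apply: product_measure_unique => B C mB mC.
rewrite -[RHS](xi_eta mB mC); congr (P _).
Qed.

Let FG (z : R * R) : \bar R := (F z.1 * G z.2)%:E.

Let mFG : measurable_fun [set: R * R] FG.
Proof.
apply/measurable_EFinP/measurable_funM.
- exact: measurableT_comp mF measurable_fst.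
- exact: measurableT_comp mG measurable_snd.
Qed.

Let F_law : P_xi.-integrable [set: R] (EFin \o F).
Proof.
apply: integrable_pushforward => //; exact/measurable_EFinP.
Qed.

Let G_law : P_eta.-integrable [set: R] (EFin \o G).
Proof.
apply: integrable_pushforward => //; exact/measurable_EFinP.
Qed.

Let FG_law : (P_xi \x P_eta)%E.-integrable [set: R * R] FG.
Proof.
apply/integrable12ltyP => //.
under eq_integral => x _.
  under eq_integral => y _ do rewrite /FG/= normrM EFinM.
  rewrite ge0_integralZl//; last exact/measurable_EFinP/measurableT_comp.
  over.
rewrite ge0_integralZr//; last 2 first.
- exact/measurable_EFinP/measurableT_comp.
- exact: integral_ge0.
have /integrableP[_ Foo] := F_law; have /integrableP[_ Goo] := G_law.
apply: lte_mul_pinfty => //; rewrite ?integral_ge0//.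
by rewrite ge0_fin_numE ?integral_ge0.
Qed.

Let FG_joint : P.-integrable [set: T] (FG \o joint).
Proof.
apply/integrableP; split.
  exact: (measurableT_comp mFG (measurable_funPT joint)).
have mabsFG : measurable_fun [set: R * R] (abse \o FG).
  exact: measurableT_comp.
rewrite -(ge0_integral_distribution joint mabsFG (fun z => abse_ge0 (FG z))).
rewrite (@eq_measure_integral _ _ _ _ (P_xi \x P_eta)%E); last first.
  by move=> A mA _; exact/esym/jointE.
by have /integrableP[] := FG_law.
Qed.

Lemma independent_integrableM :
  P.-integrable [set: T] (fun w => (F (xi w) * G (eta w))%:E).
Proof. exact: FG_joint. Qed.

Lemma independent_integralM :
  (\int[P]_w (F (xi w) * G (eta w))%:E =
   \int[P]_w (F (xi w))%:E * \int[P]_w (G (eta w))%:E)%E.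
Proof.
rewrite -[LHS](@integral_distribution _ _ _ _ _ P joint FG)//.
rewrite (@eq_measure_integral _ _ _ _ (P_xi \x P_eta)%E); last first.
  by move=> A mA _; exact/esym/jointE.
rewrite -integral12_prod_meas1// /fubini_F.
rewrite -(@integral_distribution _ _ _ _ _ P eta (EFin \o G))//; last first.
  exact/measurable_EFinP.
have Gfin := integrable_fin_num measurableT G_law.
under eq_integral => x _.
  under eq_integral => y _ do rewrite /FG/= EFinM.
  rewrite integralZl//; over.
rewrite /= -/P_eta -(fineK Gfin) integralZr// fineK//.
rewrite -(@integral_distribution _ _ _ _ _ P xi (EFin \o F))//.
exact/measurable_EFinP.
Qed.

End independent_product.

(** * Integrals over the line and the half-line *)

Section reflection.
Context (R : realType) (f : R -> R).
Notation mu := (@lebesgue_measure R).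
Hypothesis fi : mu.-integrable [set: R] (EFin \o f).

Let mN : measurable_fun [set: measurableTypeR R]
  (-%R : measurableTypeR R -> measurableTypeR R).
Proof. exact: oppr_measurable. Qed.

Let mfE : measurable_fun [set: R] (EFin \o f).
Proof. exact: measurable_int fi. Qed.

Lemma integrable_oppr : mu.-integrable [set: R] (EFin \o (f \o -%R)).
Proof.
apply/integrableP; split; first exact: measurableT_comp mfE mN.
have mfabs : measurable_fun [set: R] (abse \o (EFin \o f)).
  exact: measurableT_comp.
have := ge0_integral_pushforward mN lebesgue_measure measurableT mfabs.
rewrite preimage_setT => /(_ (fun x _ => abse_ge0 _)) <-.
have /integrableP[_] := fi; apply: le_lt_trans; rewrite le_eqVlt.
apply/orP; left; apply/eqP.
by apply: eq_measure_integral => A mA _; exact: lebesgue_measureN.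
Qed.

(** A symmetric treatment of the two half-lines: the contributions of an odd
    function cancel, those of an even one add up. *)
Lemma integral_fold :
  \int[mu]_x f x = \int[mu]_(x in `]0, +oo[) (f x + f (- x)).
Proof.
have preN : -%R @^-1` `]-oo, (0 : R)] = `[0, +oo[%classic.
  by apply/seteqP; split => x /=; rewrite !in_itv/= ?andbT oppr_le0.
have foi D : measurable D -> mu.-integrable D (EFin \o (f \o -%R)).
  by move=> mD; apply: integrableS integrable_oppr.
have fiS D : measurable D -> mu.-integrable D (EFin \o f).
  by move=> mD; apply: integrableS fi.
have fNE : \int[mu]_(x in `]0, +oo[) f (- x) = \int[mu]_(x in `]-oo, 0]) f x.
  rewrite Rintegral_itv_obnd_cbnd; last exact: foi.
  rewrite /Rintegral -preN; congr fine.
  rewrite -(integral_pushforward mN mfE)//; last first.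
    by rewrite preN; exact: foi.
  by apply: eq_measure_integral => A mA _; exact: lebesgue_measureN.
rewrite RintegralD//; [|exact: fiS|exact: foi].
rewrite fNE addrC -Rintegral_setU//; last 2 first.
- by apply: fiS; exact: measurableU.
- apply/disj_setPS => x /= []; rewrite !in_itv/= andbT => x0.
  by rewrite ltNge x0.
congr (Rintegral _ _ _); apply/seteqP; split => x //= _.
by rewrite !in_itv/= andbT; case: (leP x 0) => _; [left|right].
Qed.

End reflection.

Section half_line_calculus.
Context {R : realType}.
Notation mu := (@lebesgue_measure R).
Local Notation pos := (`]0%R, +oo[%classic : set R).

Lemma integral_derive_segment (F f : R -> R) (x y : R) : 0 < x -> x < y ->
  (forall t : R, 0 < t -> is_derive t 1 F (f t)) ->
  (forall t : R, 0 < t -> {for t, continuous f}) ->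
  (\int[mu]_(t in `[x, y]) (f t)%:E = (F y - F x)%:E)%E.
Proof.
move=> x0 xy dF cf; rewrite EFinB.
have dF' t : 0 < t -> derivable F t 1 by move=> /dF[].
have cF t : 0 < t -> {for t, continuous F}.
  by move=> /dF' /derivable1_diffP; exact: differentiable_continuous.
apply: continuous_FTC2 => //.
- apply: continuous_in_subspaceT => t; rewrite inE/= in_itv/= => /andP[xt _].
  by apply: cf; exact: lt_le_trans xt.
- split=> [t| |].
  + by rewrite in_itv/= => /andP[xt _]; apply: dF'; exact: lt_trans xt.
  + exact: cvg_at_right_filter (cF _ x0).
  + exact: cvg_at_left_filter (cF _ (lt_trans x0 xy)).
- move=> t; rewrite in_itv/= => /andP[xt _].
  by rewrite derive1E; have [_ ->] := dF _ (lt_trans x0 xt).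
Qed.

(* An exhaustion of the open half-line by compact segments. *)
Let seg n : set R := `[n.+2%:R^-1, n.+2%:R]%classic.

Let seg_lt n : n.+2%:R^-1 < n.+2%:R :> R.
Proof.
by rewrite (@lt_trans _ _ 1) ?invf_lt1 ?ltr1n ?ltr0n.
Qed.

Let mseg n : measurable (seg n). Proof. exact: measurable_itv. Qed.

Let near_seg (t : R) : 0 < t -> \forall n \near \oo, seg n t.
Proof.
move=> t0; near=> n; rewrite /seg/= in_itv/=; apply/andP; split.
  rewrite invf_ple ?posrE// (@le_trans _ _ n%:R)//.
    by near: n; exact: nbhs_infty_ger.
  by rewrite ler_nat leqW.
rewrite (@le_trans _ _ n%:R)//; first by near: n; exact: nbhs_infty_ger.
by rewrite ler_nat leqW.
Unshelve. all: by end_near. Qed.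

Let sub_seg n : seg n `<=` pos.
Proof.
move=> t; rewrite /seg/= !in_itv/= andbT => /andP[+ _]; apply: lt_le_trans.
by rewrite invr_gt0.
Qed.

(** On each segment the integral of f is an increment of F, hence at most twice
    the bound of F; monotone convergence does the rest. *)
Lemma derive_bounded_integrable (F f : R -> R) (M : R) :
  (forall t : R, 0 < t -> is_derive t 1 F (f t)) ->
  (forall t : R, 0 < t -> {for t, continuous f}) ->
  (forall t : R, 0 < t -> 0 <= f t) ->
  (forall t : R, 0 < t -> `|F t| <= M) ->
  mu.-integrable pos (EFin \o f).
Proof.
move=> dF cf f0 FM.
have mf : measurable_fun pos (EFin \o f).
  apply/measurable_EFinP; apply: open_continuous_measurable_fun => // t.
  by rewrite inE/= in_itv/= andbT; exact: cf.
apply/integrableP; split => //.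
have -> : (\int[mu]_(t in pos) `|(EFin \o f) t| =
           \int[mu]_(t in pos) (f t)%:E)%E.
  apply: eq_integral => t; rewrite inE/= in_itv/= andbT => t0.
  by rewrite ger0_norm ?f0.
have segT : \bigcup_n seg n = pos.
  apply/seteqP; split => [t [n _]|t /=]; first exact: sub_seg.
  by rewrite in_itv/= andbT => /near_seg[n _ /(_ n (leqnn n))]; exists n.
have segcvg : (\int[mu]_(t in seg n) (f t)%:E)%E @[n --> \oo] -->
    (\int[mu]_(t in pos) (f t)%:E)%E.
  rewrite -segT; apply: ge0_nondecreasing_set_cvg_integral => //.
  - move=> m n mn; apply/subsetPset => t; rewrite /seg/= !in_itv/=.
    move=> /andP[t1 t2]; apply/andP; split.
      by rewrite (le_trans _ t1)// lef_pV2 ?posrE// ler_nat.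
    by rewrite (le_trans t2)// ler_nat.

  - by move=> n; exact: (measurable_funS (measurable_itv _) (@sub_seg n) mf).
  - by move=> n t /sub_seg/=; rewrite in_itv/= andbT lee_fin => /f0.
rewrite -(cvg_lim _ segcvg)//.
apply: (@le_lt_trans _ _ (M + M)%:E); last exact: ltry.
apply: lime_le.
  apply/cvg_ex; exists (\int[mu]_(t in pos) (f t)%:E)%E; exact: segcvg.
apply: nearW => n; rewrite (integral_derive_segment _ (seg_lt n) dF cf)//.
rewrite lee_fin lerD//.
  by rewrite (le_trans (ler_norm _))// FM.
by rewrite (le_trans (ler_norm _))// normrN FM// invr_gt0.
Qed.


(** The fundamental theorem of calculus on the open half-line, with F going to 0
    at both ends: the increments of F on the exhausting segments tend to 0. *)
Lemma integral_derive_vanishing (F f : R -> R) :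
  (forall t : R, 0 < t -> is_derive t 1 F (f t)) ->
  (forall t : R, 0 < t -> {for t, continuous f}) ->
  mu.-integrable pos (EFin \o f) ->
  F t @[t --> 0^'+] --> 0 -> F t @[t --> +oo] --> 0 ->
  \int[mu]_(t in pos) f t = 0.
Proof.
move=> dF cf fi F0 Fy.
have mf := measurable_int _ fi.
pose fn n : R -> \bar R := (EFin \o f) \_ (seg n).
have segI n : pos `&` seg n = seg n by apply/setIidPr; exact: sub_seg.
have mfn n : measurable_fun pos (fn n).
  apply/(measurable_restrict _ (mseg n)) => //; rewrite segI.
  exact: (measurable_funS (measurable_itv _) (@sub_seg n) mf).
have fnf t : pos t -> fn ^~ t @ \oo --> (EFin \o f) t.
  rewrite /= in_itv/= andbT => t0; apply: cvg_near_cst.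
  by apply: filterS (near_seg t0) => n nt; rewrite /fn patchE mem_set.
have fnle t n : pos t -> (`|fn n t| <= (abse \o (EFin \o f)) t)%E.
  by move=> _; rewrite /fn patchE; case: ifP => // _; rewrite abse0 abse_ge0.
have fncvg : (\int[mu]_(t in pos) fn n t)%E @[n --> \oo] -->
    (\int[mu]_(t in pos) (EFin \o f) t)%E.
  have [||||//] := @dominated_convergence _ _ _ mu pos _ fn (EFin \o f)
    (abse \o (EFin \o f)) mfn mf.
  - exact: measurable_itv.
  - exact: aeW.
  - exact: integrable_abse.
  - exact: aeW.
have Fn : (F n.+2%:R - F n.+2%:R^-1) @[n --> \oo] --> (0 : R).
  rewrite -[X in _ --> X](subrr 0); apply: cvgB.
    apply: ((cvg_pinftyP F 0).1 Fy); apply/cvgryPge => r.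
    near=> n; rewrite (@le_trans _ _ n%:R)//; last by rewrite ler_nat leqW.
    by near: n; exact: nbhs_infty_ger.
  apply: ((cvg_at_rightP F 0 0).1 F0); split=> [n|]; first by rewrite invr_gt0.
  apply/gtr0_cvgV0; first exact: nearW.
  apply/cvgryPge => r.
  near=> n; rewrite (@le_trans _ _ n%:R)//; last by rewrite ler_nat leqW.
  by near: n; exact: nbhs_infty_ger.
suff E : (\int[mu]_(t in pos) (EFin \o f) t = 0%:E)%E.
  by rewrite -[RHS]/(fine 0%:E) -E.
have fnE n : (\int[mu]_(t in pos) fn n t = (F n.+2%:R - F n.+2%:R^-1)%:E)%E.
  rewrite -integral_mkcondr segI.
  by rewrite (integral_derive_segment _ (seg_lt n) dF cf).
move: fncvg; rewrite (funext fnE) => fncvg.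
apply: (cvg_unique _ fncvg) => //.
exact: cvg_EFin (nearW _ _) Fn.
Unshelve. all: by end_near. Qed.

Lemma half_line_integrableZ (f : R -> R) k : mu.-integrable pos (EFin \o f) ->
  mu.-integrable pos (EFin \o (fun t => k * f t)).
Proof.
by move=> fi; apply: (@integrableZl _ _ _ mu _ _ k _ fi) => //.
Qed.

Lemma half_line_eq_integrable (f g : R -> R) :
  (forall t : R, 0 < t -> f t = g t) ->
  mu.-integrable pos (EFin \o f) -> mu.-integrable pos (EFin \o g).
Proof.
move=> fg; apply: eq_integrable => // t.
by rewrite inE/= in_itv/= andbT => /fg ->.
Qed.

Lemma half_line_eq_integral (f g : R -> R) :
  (forall t : R, 0 < t -> f t = g t) ->
  \int[mu]_(t in pos) f t = \int[mu]_(t in pos) g t.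
Proof.
by move=> fg; apply: eq_Rintegral => t; rewrite inE/= in_itv/= andbT => /fg.
Qed.

(** Otherwise f would vanish almost everywhere on a set of infinite measure. *)
Lemma half_line_integral_gt0 (f : R -> R) : (forall t : R, 0 < t -> 0 < f t) ->
  mu.-integrable pos (EFin \o f) -> 0 < \int[mu]_(t in pos) f t.
Proof.
move=> f_gt0 fi.
rewrite lt_neqAle Rintegral_ge0 ?andbT; last first.
  by move=> t /=; rewrite in_itv/= andbT => /f_gt0/ltW.
apply/eqP => f_int0.
have : (\int[mu]_(t in pos) `|(EFin \o f) t| = 0)%E.
  transitivity (\int[mu]_(t in pos) (EFin \o f) t)%E.
    apply: eq_integral => t; rewrite inE/= in_itv/= andbT => /f_gt0/ltW ft.
    by rewrite ger0_norm.
  have ffin : (\int[mu]_(t in pos) (EFin \o f) t)%E \is a fin_num.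
    exact: integrable_fin_num fi.
  by rewrite -(fineK ffin) -[fine _]f_int0.
move/(ae_eq_integral_abs mu (measurable_itv _) (measurable_int _ fi)) => f_ae0.
have : mu.-negligible pos.
  apply: negligibleS f_ae0 => t /=; rewrite in_itv/= andbT => t0 /(_ _)/eqP.
  by move=> /(_ t0); rewrite eqe gt_eqF ?f_gt0.
move=> pos_negl; have : mu pos = 0%E by exact: measure_negligible.
by rewrite lebesgue_measure_itv/= ltry.
Qed.


End half_line_calculus.

Section half_line_densities.
Context {R : realType}.
Notation mu := (@lebesgue_measure R).
Local Notation pos := (`]0%R, +oo[%classic : set R).

Lemma patch_pos (f : R -> R) : (forall x, x <= 0 -> f x = 0) -> f \_ pos = f.
Proof.
move=> f0; apply/funext => x; rewrite patchE.
case: ifPn => //; rewrite notin_setE/= in_itv/= andbT => /negP.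
by rewrite -leNgt => /f0.
Qed.

Lemma integrable_pos_support (f : R -> R) : (forall x, x <= 0 -> f x = 0) ->
  mu.-integrable pos (EFin \o f) -> mu.-integrable [set: R] (EFin \o f).
Proof.
move=> f0 fi; rewrite -(patch_pos f0) -restrict_EFin.
have mpos : measurable (pos : set (measurableTypeR R)) by exact: measurable_itv.
exact/(integrable_mkcond _ mpos).
Qed.

Lemma integral_pos_support (f : R -> R) : (forall x, x <= 0 -> f x = 0) ->
  \int[mu]_x f x = \int[mu]_(x in pos) f x.
Proof. by move=> f0; rewrite [RHS]Rintegral_mkcond patch_pos. Qed.

(** The function is bounded by h(x) + h(-x), where h is its restriction to the
    closed half-line; keeping 0 in the half-line is what makes the bound hold at
    the origin. *)
Lemma integrable_even (f : R -> R) : measurable_fun [set: R] f ->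
  (forall x, 0 <= f x) -> (forall x, f (- x) = f x) ->
  mu.-integrable pos (EFin \o f) -> mu.-integrable [set: R] (EFin \o f).
Proof.
move=> mf f0 fN fi.
pose h := f \_ `[0%R, +oo[.
have mfE : measurable_fun [set: measurableTypeR R] (EFin \o f).
  exact/measurable_EFinP.
have mabs : measurable_fun [set: measurableTypeR R] (abse \o (EFin \o f)).
  exact: measurableT_comp.
have mclosed : measurable (`[0%R, +oo[ : set (measurableTypeR R)).
  exact: measurable_itv.
have hi : mu.-integrable [set: R] (EFin \o h).
  rewrite /h -restrict_EFin; apply/(integrable_mkcond _ mclosed).
  apply/integrableP; split.
    exact: (measurable_funS measurableT (@subsetT _ _) mfE).
  rewrite -integral_itv_obnd_cbnd; first by have /integrableP[] := fi.
  exact: (measurable_funS measurableT (@subsetT _ _) mabs).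
have hNi := integrable_oppr hi.
have hD : mu.-integrable [set: R] (EFin \o (fun x => h x + h (- x))).
  rewrite (_ : _ \o _ = (EFin \o h) \+ (EFin \o (h \o -%R)))%E//.
  exact: integrableD.
apply: (le_integrable _ mfE _ hD) => //.
move=> x _; rewrite /= lee_fin !ger0_norm//; last first.
  by rewrite addr_ge0// /h patchE; case: ifP.
rewrite /h !patchE; case: ifPn => [_|].
  by rewrite lerDl; case: ifP.
rewrite notin_setE/= in_itv/= andbT => /negP; rewrite -ltNge => x0.
by rewrite add0r mem_set ?fN//= in_itv/= andbT oppr_ge0 ltW.
Qed.

End half_line_densities.

(** * Rotation of the half-line of integration *)

(** The rules below are stated for lambda-abstractions, so that they can be
    composed as terms: unification then never has to guess a function. *)
Section pointwise_derivatives.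
Context {R : realType}.
Implicit Types (f g : R -> R) (x df dg k : R).

Lemma is_derive1_mul f g x df dg : is_derive x 1 f df -> is_derive x 1 g dg ->
  is_derive x 1 (fun t => f t * g t) (f x * dg + g x * df).
Proof. by move=> hf hg; exact: (is_deriveM (f := f) (g := g)). Qed.

Lemma is_derive1_scale k f x df : is_derive x 1 f df ->
  is_derive x 1 (fun t => k * f t) (k * df).
Proof. by move=> hf; exact: (is_deriveZ (f := f) k). Qed.

Lemma is_derive1_cstB k f x df : is_derive x 1 f df ->
  is_derive x 1 (fun t => k - f t) (- df).
Proof.
move=> hf; rewrite -[- df]add0r.
exact: (is_deriveB (is_derive_cst k x 1) hf).
Qed.

Lemma is_derive1_oppr f x df : is_derive x 1 f df ->
  is_derive x 1 (fun t => - f t) (- df).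
Proof. by move=> hf; exact: (is_deriveN (f := f)). Qed.

Lemma is_derive1_expR f x df : is_derive x 1 f df ->
  is_derive x 1 (fun t => expR (f t)) (expR (f x) * df).
Proof. by move=> hf; exact: (is_derive1_comp (is_derive_expR (f x)) hf). Qed.

Lemma is_derive1_sin f x df : is_derive x 1 f df ->
  is_derive x 1 (fun t => sin (f t)) (cos (f x) * df).
Proof. by move=> hf; exact: (is_derive1_comp (is_derive_sin (f x)) hf). Qed.

Lemma is_derive1_cos f x df : is_derive x 1 f df ->
  is_derive x 1 (fun t => cos (f t)) (- sin (f x) * df).
Proof. by move=> hf; exact: (is_derive1_comp (is_derive_cos (f x)) hf). Qed.

Lemma is_derive1_continuous f x df :
  is_derive x 1 f df -> {for x, continuous f}.
Proof.
by move=> [/derivable1_diffP/differentiable_continuous].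
Qed.

End pointwise_derivatives.

Lemma cos_gt0_acute (R : realType) (th : R) : 0 <= th < pi / 2 -> 0 < cos th.
Proof.
move=> /andP[th0 th2]; rewrite cos_gt0_pihalf// th2 andbT.
by rewrite (lt_le_trans _ th0)// oppr_lt0 divr_gt0// pi_gt0.
Qed.

Lemma measurable_cos (R : realType) : measurable_fun [set: R] cos.
Proof. by apply: continuous_measurable_fun; exact: continuous_cos. Qed.

(** In the application A(t) = a t^p + b t^-p and B(t) = a t^p - b t^-p, so that
    cos th * A and sin th * B are the real and imaginary parts of
    z a t^p + b / (z t^p) for z = exp(i th).  The relations t A' = p B and
    t B' = p A are the Cauchy-Riemann equations of this family; they turn the
    angle derivative into a derivative in t.
    The hypothesis [decay] bounds the weight by t^be at 0 and by t^-be at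
    infinity, in a form whose quotient by t has a bounded primitive. *)
Section contour_rotation.
Context {R : realType}.
Notation mu := (@lebesgue_measure R).
Local Notation pos := (`]0%R, +oo[%classic : set R).
Variables (A B : R -> R) (p al : R).
Hypothesis p0 : 0 < p.
Hypothesis dA : forall t : R, 0 < t -> is_derive t 1 A (p * B t / t).
Hypothesis dB : forall t : R, 0 < t -> is_derive t 1 B (p * A t / t).
Hypothesis BA : forall t : R, 0 < t -> `|B t| <= A t.
Hypothesis decay : forall c : R, 0 < c -> exists2 be, 0 < be &
  exists C : R, forall t, 0 < t ->
    t `^ al * expR (- (c * A t)) <= C * (t `^ be / (1 + t `^ be) ^+ 2).

Let wave (ph th t : R) :=
  t `^ (al - 1) * expR (- (cos th * A t)) * cos (ph - sin th * B t).

Let rotated (ph th t : R) :=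
  t `^ al * expR (- (cos th * A t)) * sin (ph - sin th * B t).

Let drotated (ph th t : R) :=
  t `^ (al - 1) * expR (- (cos th * A t)) *
  (al * sin (ph - sin th * B t)
   - p * (cos th * B t * sin (ph - sin th * B t)
          + sin th * A t * cos (ph - sin th * B t))).

Let powRB1E (t x : R) : 0 < t -> t `^ (x - 1) = t `^ x / t.
Proof.
move=> t0; rewrite powRB ?powRr1 ?ltW//.
by rewrite (gt_eqF t0) implybT.
Qed.

Let d_expA (c : R) {t : R} (t0 : 0 < t) :=
  is_derive1_expR (is_derive1_oppr (is_derive1_scale c (dA t0))).

Let d_phase (ph c : R) {t : R} (t0 : 0 < t) :=
  is_derive1_cstB ph (is_derive1_scale c (dB t0)).

(** Up to the factor -p, the right-hand side is also the derivative of the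
    integrand with respect to the angle, see [is_derive_angle]: this is what
    makes the integral constant in the angle. *)
Let is_derive_rotated (ph th t : R) : 0 < t ->
  is_derive t 1 (rotated ph th) (drotated ph th t).
Proof.
move=> t0.
have := is_derive1_mul
  (is_derive1_mul (is_derive1_powR al t0) (d_expA (cos th) t0))
  (is_derive1_sin (d_phase ph (sin th) t0)).
move=> /is_derive_eq; apply.
rewrite /drotated !powRB1E//; field; exact: lt0r_neq0.
Qed.

Let wave_continuous (ph th t : R) : 0 < t -> {for t, continuous (wave ph th)}.
Proof.
move=> t0.
exact: (is_derive1_continuous (is_derive1_mul
  (is_derive1_mul (is_derive1_powR (al - 1) t0) (d_expA (cos th) t0))
  (is_derive1_cos (d_phase ph (sin th) t0)))).
Qed.

Let drotated_continuous (ph th t : R) :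
  0 < t -> {for t, continuous (drotated ph th)}.
Proof.
move=> t0.
have dsin := is_derive1_sin (d_phase ph (sin th) t0).
have dcos := is_derive1_cos (d_phase ph (sin th) t0).
have dosc := is_deriveB (is_derive1_scale al dsin) (is_derive1_scale p
  (is_deriveD (is_derive1_mul (is_derive1_scale (cos th) (dB t0)) dsin)
              (is_derive1_mul (is_derive1_scale (sin th) (dA t0)) dcos))).
exact: (is_derive1_continuous (is_derive1_mul
  (is_derive1_mul (is_derive1_powR (al - 1) t0) (d_expA (cos th) t0)) dosc)).
Qed.

Let mpos : measurable (pos : set (measurableTypeR R)).
Proof. exact: measurable_itv. Qed.

Let continuous_measurable (f : R -> R) :
  (forall t : R, 0 < t -> {for t, continuous f}) -> measurable_fun pos f.
Proof.
move=> cf; apply: open_continuous_measurable_fun => // t.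
by rewrite inE/= in_itv/= andbT; exact: cf.
Qed.

Let le_integrable_pos (f g : R -> R) :
  (forall t : R, 0 < t -> {for t, continuous f}) ->
  (forall t : R, 0 < t -> `|f t| <= g t) ->
  mu.-integrable pos (EFin \o g) -> mu.-integrable pos (EFin \o f).
Proof.
move=> cf fg gi; apply: (le_integrable _ _ _ gi) => //.
  by apply/measurable_EFinP; exact: continuous_measurable cf.
move=> t; rewrite /= in_itv/= andbT => t0.
by rewrite lee_fin (le_trans (fg _ t0))// ler_norm.
Qed.

Let powR_div_derive (be t : R) : 0 < t ->
  is_derive t 1 (fun t => 1 - (1 + t `^ be)^-1)
    (be * t `^ (be - 1) / (1 + t `^ be) ^+ 2).
Proof.
move=> t0; have e0 : 1 + t `^ be != 0.
  by rewrite gt_eqF// ltr_wpDr// powR_ge0.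
have d1 := is_deriveD (is_derive_cst (1 : R) t 1) (is_derive1_powR be t0).
have d2 := is_deriveV (f := fun t => 1 + t `^ be) e0 d1.
have := is_derive1_cstB 1 d2.
move=> /is_derive_eq; apply.
rewrite add0r -scaleNr opprK; exact: mulrC.
Qed.

Let env (c t : R) := t `^ (al - 1) * expR (- (c * A t)).

Let env_ge0 c t : 0 <= env c t.
Proof. by rewrite mulr_ge0 ?powR_ge0 ?expR_ge0. Qed.

Let env_continuous (c t : R) : 0 < t -> {for t, continuous (env c)}.
Proof.
move=> t0.
exact: (is_derive1_continuous
  (is_derive1_mul (is_derive1_powR (al - 1) t0) (d_expA c t0))).
Qed.

(** The primitive is t^be / (1 + t^be), which stays between 0 and 1. *)
Let sigmoid_integrable (be : R) : 0 < be -> mu.-integrable pos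
  (EFin \o (fun t => be * t `^ (be - 1) / (1 + t `^ be) ^+ 2)).
Proof.
move=> be0; have e0 (t : R) : 0 < 1 + t `^ be by rewrite ltr_wpDr// powR_ge0.
apply: (@derive_bounded_integrable _ (fun t => 1 - (1 + t `^ be)^-1)
  (fun t => be * t `^ (be - 1) / (1 + t `^ be) ^+ 2) 1).
- by move=> t t0; exact: powR_div_derive.
- move=> t t0; have e2 : (1 + t `^ be) ^+ 2 != 0 by rewrite expf_neq0// gt_eqF.
  have dpow := is_derive1_powR be t0.
  have d1 := is_deriveD (is_derive_cst (1 : R) t 1) dpow.
  have d2 := is_deriveV (f := fun t => (1 + t `^ be) ^+ 2) e2
    (is_derive1_mul d1 d1).
  exact: (is_derive1_continuous (is_derive1_mul
    (is_derive1_scale be (is_derive1_powR (be - 1) t0)) d2)).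
- by move=> t t0; rewrite divr_ge0 ?mulr_ge0 ?exprn_ge0 ?powR_ge0 ?ltW.
- move=> t t0; rewrite ger0_norm.
    by rewrite lerBlDr lerDl invr_ge0 ltW.
  by rewrite subr_ge0 invf_le1// lerDl powR_ge0.
Qed.

Let env_integrable c : 0 < c -> mu.-integrable pos (EFin \o env c).
Proof.
move=> c0; have [be be0 [C envC]] := decay c0.
apply: (@le_integrable_pos _
  (fun t => C / be * (be * t `^ (be - 1) / (1 + t `^ be) ^+ 2))).
- by move=> t; exact: env_continuous.
- move=> t t0; rewrite ger0_norm ?env_ge0// /env !powRB1E//.
  rewrite (_ : C / be * _ = C * (t `^ be / (1 + t `^ be) ^+ 2) / t).
    by rewrite mulrAC ler_pM2r ?invr_gt0// envC.
  field; rewrite !gt_eqF//.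
  by rewrite ltr_wpDr// powR_ge0.
- exact: half_line_integrableZ (sigmoid_integrable be0).
Qed.

Let env_dominated (f : R -> R) (K c : R) : 0 < c ->
  (forall t : R, 0 < t -> {for t, continuous f}) ->
  (forall t : R, 0 < t -> `|f t| <= K * env c t) ->
  mu.-integrable pos (EFin \o f).
Proof.
move=> c0 cf fK.
apply: (@le_integrable_pos _ (fun t => K * env c t)) => //.
exact: half_line_integrableZ (env_integrable c0).
Qed.

Let wave_le (ph th t : R) : `|wave ph th t| <= env (cos th) t.
Proof. by rewrite normrM ger0_norm ?env_ge0// ler_piMr ?env_ge0// cos_max. Qed.

Let wave_integrable ph th : 0 < cos th ->
  mu.-integrable pos (EFin \o wave ph th).
Proof.
move=> c0; apply: (@env_dominated _ 1 _ c0) => t t0.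
  exact: wave_continuous.
by rewrite mul1r wave_le.
Qed.

(** The bound is uniform in the angles whose cosine is at least c, as
    differentiation under the integral sign requires. *)
Let drotated_le (c ph th t : R) : 0 < c -> c <= cos th -> 0 < t ->
  `|drotated ph th t| <= (`|al| + 4 * p / c) * env (c / 2) t.
Proof.
move=> c0 cth t0.
have A0 : 0 <= A t by exact: le_trans (BA t0).
have B' := BA t0.
have sin1 x : `|sin x| <= 1 :> R by exact: sin_max.
have cos1 x : `|cos x| <= 1 :> R by exact: cos_max.
have osc : `|al * sin (ph - sin th * B t)
   - p * (cos th * B t * sin (ph - sin th * B t)
          + sin th * A t * cos (ph - sin th * B t))| <= `|al| + p * (A t + A t).
  rewrite (le_trans (ler_normB _ _))// lerD//.
    by rewrite normrM ler_piMr.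
  rewrite normrM (gtr0_norm p0) ler_wpM2l ?(ltW p0)//.
  rewrite (le_trans (ler_normD _ _))// lerD// !normrM.
    rewrite (le_trans _ B')// (le_trans (ler_piMr _ (sin1 _))) ?mulr_ge0//.
    by rewrite ler_piMl.
  rewrite (ger0_norm A0) (le_trans (ler_piMr _ (cos1 _))) ?mulr_ge0//.
  by rewrite ler_piMl.
set e := expR (- (c / 2 * A t)).
have e_gt0 : 0 < e by exact: expR_gt0.
have e_le1 : e <= 1.
  by rewrite -expR0 ler_expR oppr_le0 mulr_ge0// divr_ge0// ltW.
(* x exp(-x) <= 1: half of the exponential absorbs the factor A. *)
have Ae : A t * e <= 2 / c.
  rewrite /e expRN ler_pdivrMr ?expR_gt0// mulrC -ler_pdivrMr ?divr_gt0//.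
  rewrite invf_div mulrC (le_trans _ (expR_ge1Dx _))//.
  by rewrite lerDr.
have Ee : expR (- (cos th * A t)) <= e * e.
  rewrite -expRD ler_expR -opprD lerN2 -mulrDl ler_wpM2r//.
  by rewrite -splitr.
rewrite /drotated /env -/e !normrM (ger0_norm (powR_ge0 _ _)).
rewrite (gtr0_norm (expR_gt0 _)) -mulrA [leRHS]mulrCA ler_wpM2l ?powR_ge0//.
rewrite (le_trans (ler_pM _ _ Ee osc)) ?expR_ge0//.
have pAe : p * (A t * e) <= p * (2 / c) by exact: ler_wpM2l (ltW p0) _ _ Ae.
rewrite -subr_ge0 (_ : _ - _ = `|al| * (e * (1 - e))
  + 2 * e * (p * (2 / c) - p * (A t * e))); last first.
  by field; exact: lt0r_neq0.
by rewrite addr_ge0// !mulr_ge0// ?subr_ge0// ltW.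
Qed.

Let drotated_integrable ph th : 0 < cos th ->
  mu.-integrable pos (EFin \o drotated ph th).
Proof.
move=> c0; have c20 : 0 < cos th / 2 by rewrite divr_gt0.
apply: (env_dominated c20); first by move=> t; exact: drotated_continuous.
by move=> t t0; exact: drotated_le.
Qed.

Let rotated_le ph th : 0 < cos th -> exists2 be, 0 < be &
  exists C, forall t : R, 0 < t ->
    `|rotated ph th t| <= C * (t `^ be / (1 + t `^ be) ^+ 2).
Proof.
move=> c0; have [be be0 [C decayC]] := decay c0; exists be => //.
exists C => t t0; rewrite (le_trans _ (decayC _ t0))// normrM.
rewrite ger0_norm ?mulr_ge0 ?powR_ge0 ?expR_ge0//.
by rewrite ler_piMr ?mulr_ge0 ?powR_ge0 ?expR_ge0// sin_max.
Qed.

Let rotated_cvg (F : set_system R) (FF : Filter F) ph th :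
  0 < cos th -> (\forall t \near F, 0 < t) ->
  (forall be, 0 < be -> exists2 h : R -> R, h t @[t --> F] --> 0 &
    \forall t \near F, t `^ be / (1 + t `^ be) ^+ 2 <= h t) ->
  rotated ph th t @[t --> F] --> 0.
Proof.
move=> c0 Fpos bound; have [be be0 [C rotC]] := rotated_le ph c0.
have [h h0 beh] := bound be be0.
apply: norm_cvg0; apply: (@squeeze_cvgr _ _ _ _ (cst 0) (fun t => `|C| * h t)).
- near=> t; rewrite normr_ge0/=.
  have t0 : 0 < t by near: t.
  rewrite (le_trans (rotC _ t0))// (le_trans (ler_wpM2r _ (ler_norm _)))//.
    by rewrite divr_ge0 ?exprn_ge0 ?addr_ge0 ?powR_ge0.
  by rewrite ler_wpM2l//; near: t.
- exact: cvg_cst.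
- by rewrite -[X in _ --> X](mulr0 `|C|); apply: cvgM => //; exact: cvg_cst.
Unshelve. all: by end_near. Qed.

Let rotated_cvg0 ph th : 0 < cos th -> rotated ph th t @[t --> 0^'+] --> 0.
Proof.
move=> c0; apply: rotated_cvg => //; first exact: nbhs_right_gt.
move=> be be0; exists (fun t => t `^ be); first exact: powR_cvg0.
near=> t; rewrite ler_pdivrMr ?exprn_gt0 ?ltr_wpDr ?powR_ge0//.
by rewrite ler_peMr ?powR_ge0// exprn_ege1// lerDl powR_ge0.
Unshelve. all: by end_near. Qed.

Let rotated_cvgy ph th : 0 < cos th -> rotated ph th t @[t --> +oo] --> 0.
Proof.
move=> c0; apply: rotated_cvg => //; first exact: nbhs_pinfty_gt.
move=> be be0; exists (fun t => (t `^ be)^-1).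
  apply/gtr0_cvgV0; first by near=> t; rewrite powR_gt0.
  apply/cvgryPge => M; near=> t.
  have Mt : `|M| `^ be^-1 <= t by near: t; exact: nbhs_pinfty_ge.
  rewrite (le_trans (ler_norm M))//.
  rewrite -[leLHS](@powRr1 _ `|M|)// -(mulVf (lt0r_neq0 be0)) powRrM.
  by rewrite ge0_ler_powR ?nnegrE ?powR_ge0 ?(ltW be0)//
    (le_trans _ Mt)// powR_ge0.
near=> t; have t0 : 0 < t by [].
have tb : 0 < t `^ be by exact: powR_gt0.
rewrite ler_pdivrMr ?exprn_gt0 ?ltr_wpDr//; last exact: ltW.
rewrite mulrC ler_pdivlMr//.
by nra.
Unshelve. all: by end_near. Qed.

Let integral_drotated ph th : 0 < cos th ->
  \int[mu]_(t in pos) drotated ph th t = 0.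
Proof.
move=> c0; apply: (@integral_derive_vanishing _ (rotated ph th)).
- by move=> t; exact: is_derive_rotated.
- by move=> t; exact: drotated_continuous.
- exact: drotated_integrable.
- exact: rotated_cvg0.
- exact: rotated_cvgy.
Qed.

(** The term al / p * th in the phase compensates the phase of the rotated
    integral; with it the angle derivative is a total derivative in t. *)
Let is_derive_angle (ph t th : R) : 0 < t ->
  is_derive th 1 (fun th => wave (ph + al / p * th) th t)
    (- p^-1 * drotated (ph + al / p * th) th t).
Proof.
move=> t0.
have dE := is_derive1_expR
  (is_derive1_oppr
    (is_derive1_mul (is_derive_cos th) (is_derive_cst (A t) th 1))).
have dlin := is_deriveD (is_derive_cst ph th 1)
  (is_derive1_scale (al / p) (is_derive_id th 1)).
have dph := is_derive1_cos (is_deriveB dlin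
  (is_derive1_mul (is_derive_sin th) (is_derive_cst (B t) th 1))).
have := is_derive1_mul (is_derive1_scale (t `^ (al - 1)) dE) dph.
move=> /is_derive_eq; apply.
rewrite /drotated /=; field; exact: lt0r_neq0.
Qed.

Let cos_le (r th : R) : 0 <= r < pi -> `|th| <= r -> cos r <= cos th.
Proof.
move=> /andP[r0 rpi] thr; rewrite -(cos_norm th).
have := thr; rewrite le_eqVlt => /predU1P[->//|thr'].
rewrite ltW// ltr_cos// in_itv/= ?normr_ge0 ?r0 ?(ltW rpi)//.
by rewrite (le_trans thr (ltW rpi)).
Qed.

Let is_derive_integral_wave (ph th : R) : `|th| < pi / 2 ->
  is_derive th 1 (fun th => \int[mu]_(t in pos) wave (ph + al / p * th) th t) 0.
Proof.
move=> th_lt; pose r := (`|th| + pi / 2) / 2.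
(* r is an angle strictly between |th| and a right angle. *)
have thr : `|th| < r by rewrite /r; lra.
have rlt : r < pi / 2 by rewrite /r; lra.
have r0 : 0 <= r by exact: le_trans (ltW thr).
have pi0 : 0 < pi :> R by exact: pi_gt0.
have c0 : 0 < cos r.
  by rewrite cos_gt0_pihalf// rlt andbT (lt_le_trans _ r0)// oppr_lt0 divr_gt0.
have cos_r x : `]-r, r[%classic x -> cos r <= cos x.
  rewrite /= in_itv/= -ltr_norml => /ltW; apply: cos_le.
  by rewrite r0/=; lra.
pose K := p^-1 * (`|al| + 4 * p / cos r).
have K0 : 0 <= K.
  by rewrite mulr_ge0 ?invr_ge0 ?addr_ge0 ?divr_ge0 ?mulr_ge0// ltW.
have Ith : `]-r, r[%classic th by rewrite /= in_itv/= -ltr_norml.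
have wi x : `]-r, r[%classic x ->
    mu.-integrable pos (EFin \o wave (ph + al / p * x) x).
  by move=> /cos_r xr; apply: wave_integrable; exact: lt_le_trans xr.
have wd x t : `]-r, r[%classic x -> pos t ->
    derivable (fun x => wave (ph + al / p * x) x t) x 1.
  by move=> _; rewrite /= in_itv/= andbT => /(is_derive_angle ph x)[].
have partE x t : 0 < t ->
    partial1of2 (fun x t => wave (ph + al / p * x) x t) x t =
    - p^-1 * drotated (ph + al / p * x) x t.
  by move=> t0; rewrite partial1of2E; have [_ ->] := is_derive_angle ph x t0.
have Gi : mu.-integrable pos (EFin \o (fun t => K * env (cos r / 2) t)).
  by apply: half_line_integrableZ; apply: env_integrable; rewrite divr_gt0.
have G0 t : 0 <= K * env (cos r / 2) t by rewrite mulr_ge0.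
have wG x t : `]-r, r[%classic x -> pos t ->
    `|partial1of2 (fun x t => wave (ph + al / p * x) x t) x t|
      <= K * env (cos r / 2) t.
  move=> /cos_r xr; rewrite /= in_itv/= andbT => t0.
  have pV0 : 0 < p^-1 by rewrite invr_gt0.
  rewrite partE// normrM normrN (gtr0_norm pV0).
  by rewrite /K -[leRHS]mulrA ler_wpM2l ?(ltW pV0)// drotated_le.
split; first exact: (derivable_under_integral mpos Ith wi wd G0 Gi wG).
rewrite -derive1E (differentiation_under_integral mpos Ith wi wd G0 Gi wG).
transitivity (\int[mu]_(t in pos) (- p^-1 * drotated (ph + al / p * th) th t)).
  by apply: eq_Rintegral => t; rewrite inE/= in_itv/= andbT => t0; exact: partE.
have cth : 0 < cos th by exact: lt_le_trans (cos_r _ Ith).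
rewrite RintegralZl//; last exact: drotated_integrable.
by rewrite integral_drotated// mulr0.
Qed.

(** Real form of the rotation of the half-line of integration: the rotated
    integral is exp(-i al th / p) times the original one. *)
Lemma integral_rotation (de th : R) : 0 <= th < pi / 2 ->
  \int[mu]_(t in pos)
    (t `^ (al - 1) * expR (- (cos th * A t)) * cos (de - sin th * B t)) =
  cos (de - al / p * th) * \int[mu]_(t in pos) (t `^ (al - 1) * expR (- A t)).
Proof.
move=> /andP[th0 thlt].
pose ph := de - al / p * th.
pose F (x : R) := \int[mu]_(t in pos) wave (ph + al / p * x) x t.
have FE : F th = F 0.
  move: th0; rewrite le_eqVlt => /predU1P[<-//|th0].
  have dF x : x \in `[0, th] -> is_derive x 1 F 0.
    rewrite in_itv/= => /andP[x0 xth]; apply: is_derive_integral_wave.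
    by rewrite ger0_norm// (le_lt_trans xth).
  have dF' x : x \in `]0, th[ -> is_derive x 1 F 0.
    by move=> xth; apply: dF; exact: subset_itv_oo_cc xth.
  have cF : {within `[0, th], continuous F}.
    by apply: derivable_within_continuous => x /dF[].
  have [x _] := MVT th0 dF' cF.
  by rewrite mul0r => /eqP; rewrite subr_eq0 => /eqP.
have -> : de = ph + al / p * th by rewrite /ph subrK.
rewrite -[LHS]/(F th) FE /F addrK -RintegralZl//; last first.
  have := env_integrable ltr01.
  by apply: eq_integrable => // t _; rewrite /= /env mul1r.
apply: eq_Rintegral => t _.
by rewrite /wave cos0 sin0 mul1r mul0r subr0 mulr0 addr0 mulrC.
Qed.

Lemma integrable_rotation (de th : R) : 0 < cos th ->
  mu.-integrable pos (EFin \o (fun t =>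
    t `^ (al - 1) * expR (- (cos th * A t)) * cos (de - sin th * B t))).
Proof. exact: wave_integrable. Qed.

Lemma integrable_half_line_weight :
  mu.-integrable pos (EFin \o (fun t => t `^ (al - 1) * expR (- A t))).
Proof.
have := env_integrable ltr01.
by apply: eq_integrable => // t _; rewrite /= /env mul1r.
Qed.

End contour_rotation.

Section power_weights.
Context {R : realType}.
Notation mu := (@lebesgue_measure R).
Local Notation pos := (`]0%R, +oo[%classic : set R).

(** s = (r/c) (c s / r) <= (r/c) exp(c s / r), raised to the power r. *)
Lemma powR_expRN_le (r c s : R) : 0 < r -> 0 < c -> 0 < s ->
  s `^ r * expR (- (c * s)) <= (r / c) `^ r.
Proof.
move=> r0 c0 s0.
have s_le : s <= r / c * expR (c * s / r).
  rewrite mulrC -ler_pdivrMr ?divr_gt0// invf_div mulrCA mulrA.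
  by rewrite (le_trans _ (expR_ge1Dx _))// lerDr.
rewrite expRN ler_pdivrMr ?expR_gt0//.
have -> : expR (c * s) = expR (c * s / r) `^ r.
  rewrite /powR expR_eq0 expRK; congr expR; field; exact: lt0r_neq0.
have rc0 : 0 <= r / c by rewrite divr_ge0// ltW.
rewrite -powRM ?expR_ge0//.
by rewrite ge0_ler_powR ?nnegrE ?mulr_ge0 ?expR_ge0 ?invr_ge0
  ?(ltW r0) ?(ltW c0) ?(ltW s0).
Qed.

Variables (a b p al : R).
Hypotheses (a0 : 0 < a) (b0 : 0 <= b) (p0 : 0 < p).
Hypothesis al_b : 0 < al \/ 0 < b.

Let A (t : R) := a * t `^ p + b * t `^ (- p).
Let B (t : R) := a * t `^ p - b * t `^ (- p).

Let dA (t : R) : 0 < t -> is_derive t 1 A (p * B t / t).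
Proof.
move=> t0.
have := is_deriveD (is_derive1_scale a (is_derive1_powR p t0))
  (is_derive1_scale b (is_derive1_powR (- p) t0)).
move=> /is_derive_eq; apply; rewrite /B !powRB ?powRr1 ?(ltW t0)
  ?(gt_eqF t0) ?implybT//.
by field; exact: lt0r_neq0.
Qed.

Let dB (t : R) : 0 < t -> is_derive t 1 B (p * A t / t).
Proof.
move=> t0.
have := is_deriveB (is_derive1_scale a (is_derive1_powR p t0))
  (is_derive1_scale b (is_derive1_powR (- p) t0)).
move=> /is_derive_eq; apply; rewrite /A !powRB ?powRr1 ?(ltW t0)
  ?(gt_eqF t0) ?implybT//.
by field; exact: lt0r_neq0.
Qed.

Let BA (t : R) : 0 < t -> `|B t| <= A t.
Proof.
move=> t0; rewrite (le_trans (ler_normB _ _))// !ger0_norm//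
  mulr_ge0 ?powR_ge0//.
exact: ltW.
Qed.

(** (1 + t^be)^2 <= 2 + 2 (t^p)^r for r = 2 be / p. *)
Let decay_gt0 (be c : R) : 0 < be -> 0 < c ->
  exists C : R, forall t : R, 0 < t ->
  t `^ be * expR (- (c * t `^ p)) <= C * (t `^ be / (1 + t `^ be) ^+ 2).
Proof.
move=> be0 c0; pose r := 2 * be / p.
have r0 : 0 < r by rewrite divr_gt0// mulr_gt0.
exists (2 + 2 * (r / c) `^ r) => t t0.
have u0 : 0 < t `^ be by exact: powR_gt0.
have e0 : 0 < (1 + t `^ be) ^+ 2 by rewrite exprn_gt0// addr_gt0.
rewrite [leRHS]mulrCA ler_wpM2l ?(ltW u0)// ler_pdivlMr//.
have := @powR_expRN_le r c (t `^ p) r0 c0 (powR_gt0 _ t0).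
rewrite -powRrM (_ : p * r = be * 2%:R); last first.
  by rewrite /r; field; exact: lt0r_neq0.
rewrite powRrM powR_mulrn ?(ltW u0)// mulrC.
set e := expR _ => ue.
have e1 : e <= 1.
  by rewrite /e -expR0 ler_expR oppr_le0 mulr_ge0 ?powR_ge0 ?(ltW c0).
have e_ge0 : 0 <= e by exact: expR_ge0.
have := mulr_ge0 e_ge0 (sqr_ge0 (1 - t `^ be)).
nra.
Qed.

Let decay (c : R) : 0 < c -> exists2 be, 0 < be &
  exists C : R, forall t : R, 0 < t ->
    t `^ al * expR (- (c * A t)) <= C * (t `^ be / (1 + t `^ be) ^+ 2).
Proof.
move=> c0; have ca0 : 0 < c * a by rewrite mulr_gt0.
have eE t : expR (- (c * A t)) =
    expR (- (c * a * t `^ p)) * expR (- (c * b * t `^ (- p))).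
  by rewrite -expRD; congr expR; rewrite /A; ring.
case: al_b => [al0|b_gt0].
  exists al => //; have [C decC] := decay_gt0 al0 ca0.
  exists C => t t0; rewrite (le_trans _ (decC _ t0))// ler_wpM2l ?powR_ge0// eE.
  rewrite ler_piMr ?expR_ge0// -expR0 ler_expR oppr_le0.
  by rewrite !mulr_ge0 ?powR_ge0// ltW.
(* Near 0, exp(-b t^-p) is smaller than any power of t, which makes up for a
   nonpositive exponent al. *)
pose ga := `|al| + 1; have ga0 : 0 < ga by rewrite ltr_wpDl.
have alga : 0 < al + ga.
  by have := ler_norm (- al); rewrite normrN /ga; lra.
exists (al + ga) => //; have [C decC] := decay_gt0 alga ca0.
pose r := ga / p; have r0 : 0 < r by rewrite divr_gt0.
have cb0 : 0 < c * b by rewrite mulr_gt0.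
exists ((r / (c * b)) `^ r * C) => t t0; rewrite eE.
have tga := @powR_expRN_le r (c * b) (t `^ (- p)) r0 cb0 (powR_gt0 _ t0).
rewrite (_ : t `^ al = t `^ (al + ga) * t `^ (- p) `^ r); last first.
  rewrite -powRrM -powRD; last by rewrite (gt_eqF t0) implybT.
  by congr (_ `^ _); rewrite /r; field; exact: lt0r_neq0.
rewrite mulrACA [leLHS]mulrC -[leRHS]mulrA.
by rewrite ler_pM ?mulr_ge0 ?powR_ge0 ?expR_ge0 ?decC.
Qed.

Lemma integrable_power_weight : mu.-integrable pos
  (EFin \o (fun t => t `^ (al - 1) * expR (- (a * t `^ p + b * t `^ (- p))))).
Proof. exact: (integrable_half_line_weight dA decay). Qed.

Lemma integrable_power_rotation (de th : R) : 0 < cos th ->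
  mu.-integrable pos (EFin \o (fun t =>
    t `^ (al - 1) * expR (- (cos th * (a * t `^ p + b * t `^ (- p))))
      * cos (de - sin th * (a * t `^ p - b * t `^ (- p))))).
Proof. exact: (integrable_rotation dA dB decay). Qed.

Lemma integral_power_rotation (de th : R) : 0 <= th < pi / 2 ->
  \int[mu]_(t in pos)
    (t `^ (al - 1) * expR (- (cos th * (a * t `^ p + b * t `^ (- p))))
      * cos (de - sin th * (a * t `^ p - b * t `^ (- p)))) =
  cos (de - al / p * th) * \int[mu]_(t in pos)
    (t `^ (al - 1) * expR (- (a * t `^ p + b * t `^ (- p)))).
Proof. exact: (integral_rotation p0 dA dB BA decay). Qed.

Lemma integral_power_weight_gt0 :
  0 < \int[mu]_(t in pos)
    (t `^ (al - 1) * expR (- (a * t `^ p + b * t `^ (- p)))).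
Proof.
apply: half_line_integral_gt0 integrable_power_weight => t t0.
by rewrite mulr_gt0 ?powR_gt0 ?expR_gt0.
Qed.

End power_weights.

(** * Oscillating moments of the two factors *)

(** The generalized inverse Gaussian density, with C standing for the
    normalizing constant.  The powers 1 and -1 are real powers, the form in
    which the weights are integrated above. *)
Definition gig_pdf (R : realType) (s a b C x : R) : R :=
  if 0 < x then C * (x `^ (s - 1) * expR (- (a * x `^ 1 + b * x `^ (- 1))))
  else 0.

Section gig_moments.
Context d (T : measurableType d) (R : realType) (P : probability T R).
Notation mu := (@lebesgue_measure R).
Local Notation pos := (`]0%R, +oo[%classic : set R).
Variables (xi : {RV P >-> R}) (s a b C : R).
Hypotheses (a0 : 0 < a) (b0 : 0 <= b) (sb : 0 < s \/ 0 < b) (C0 : 0 < C).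
Hypothesis law_xi : has_law P xi
  (fun A => \int[mu]_(x in A) (gig_pdf s a b C x)%:E)%E.

Let measurable_power_sum (u v : R) :
  measurable_fun [set: R] (fun x : R => u * x `^ 1 + v * x `^ (- 1)).
Proof. by apply: measurable_funD; apply: measurable_funM => //. Qed.

Let measurable_gig_pdf : measurable_fun [set: R] (gig_pdf s a b C).
Proof.
apply: measurable_fun_ifT => //; first exact: measurable_fun_ltr.
apply: measurable_funM => //; apply: measurable_funM => //.
by apply: measurableT_comp => //; apply: measurableT_comp.
Qed.

Let gig_pdf_ge0 x : 0 <= gig_pdf s a b C x.
Proof.
rewrite /gig_pdf; case: ifP => // _.
by rewrite !mulr_ge0 ?powR_ge0 ?expR_ge0// ltW.
Qed.

Let snb n : 0 < s + n%:R \/ 0 < b.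
Proof. by case: sb => [s0|]; [left; rewrite ltr_wpDr|right]. Qed.

Variables (f : R -> R) (n : nat).
Hypothesis mf : measurable_fun [set: R] f.
Hypothesis fE : forall t, 0 < t -> f t = t ^+ n.

Let powE (t : R) : 0 < t -> t ^+ n * t `^ (s - 1) = t `^ (s + n%:R - 1).
Proof.
move=> t0; rewrite -powR_mulrn ?(ltW t0)// -powRD; last first.
  by rewrite (gt_eqF t0) implybT.
by congr (_ `^ _); ring.
Qed.

Lemma gig_integrable : P.-integrable [set: T] (EFin \o (f \o xi)).
Proof.
apply: (law_density_integrable measurable_gig_pdf gig_pdf_ge0 law_xi mf).
apply: integrable_pos_support => [x x0|].
  by rewrite /gig_pdf ltNge x0 mulr0.
apply: half_line_eq_integrable (half_line_integrableZ C
  (@integrable_power_weight _ a b 1 (s + n%:R) a0 b0 ltr01 (snb n))) => t t0.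
rewrite /gig_pdf t0 fE// -powE//; ring.
Qed.

(** Dividing a and b by cos th makes the modulus of the rotated weight equal to
    the density, so that only a cosine is left to multiply f. *)
Lemma gig_oscillating_moment (de th : R) : 0 <= th < pi / 2 ->
  (\int[P]_w (f (xi w) *
     cos (de - tan th * (a * xi w `^ 1 - b * xi w `^ (- 1))))%:E =
   (C * (cos (de - (s + n%:R) * th) * \int[mu]_(t in pos)
     (t `^ (s + n%:R - 1) *
      expR (- (a / cos th * t `^ 1 + b / cos th * t `^ (- 1))))))%:E)%E.
Proof.
move=> th_itv.
have cth : 0 < cos th by exact: cos_gt0_acute.
pose F x := f x * cos (de - tan th * (a * x `^ 1 - b * x `^ (- 1))).
have mphase : measurable_fun [set: R]
    (fun x => de - tan th * (a * x `^ 1 - b * x `^ (- 1))).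
  apply: measurable_funB => //; apply: measurable_funM => //.
  by have := measurable_power_sum a (- b); under eq_fun do rewrite mulNr.
have mF : measurable_fun [set: R] F.
  apply: measurable_funM => //.
  exact: measurableT_comp (@measurable_cos R) mphase.
have ac0 : 0 < a / cos th by rewrite divr_gt0.
have bc0 : 0 <= b / cos th by rewrite divr_ge0// ltW.
have sbc : 0 < s + n%:R \/ 0 < b / cos th.
  by case: (snb n) => [|b_gt0]; [left|right; rewrite divr_gt0].
have F_supp x : x <= 0 -> F x * gig_pdf s a b C x = 0.
  by move=> x0; rewrite /gig_pdf ltNge x0 mulr0.
have FE t : 0 < t -> F t * gig_pdf s a b C t =
    C * (t `^ (s + n%:R - 1) *
      expR (- (cos th * (a / cos th * t `^ 1 + b / cos th * t `^ (- 1)))) *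
      cos (de - sin th * (a / cos th * t `^ 1 - b / cos th * t `^ (- 1)))).
  move=> t0; rewrite /F /gig_pdf t0 fE// -powE//.
  have -> : cos th * (a / cos th * t `^ 1 + b / cos th * t `^ (- 1)) =
      a * t `^ 1 + b * t `^ (- 1) by field; exact: lt0r_neq0.
  have -> : sin th * (a / cos th * t `^ 1 - b / cos th * t `^ (- 1)) =
      tan th * (a * t `^ 1 - b * t `^ (- 1)).
    by rewrite /tan; field; exact: lt0r_neq0.
  by ring.
have Wi := @integrable_power_rotation _ _ _ 1 (s + n%:R) ac0 bc0 ltr01 sbc
  de th cth.
have Fi : mu.-integrable [set: R] (EFin \o (fun x => F x * gig_pdf s a b C x)).
  apply: integrable_pos_support => //.
  apply: half_line_eq_integrable (half_line_integrableZ C Wi) => t t0.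
  by rewrite FE.
rewrite (law_density_integral measurable_gig_pdf gig_pdf_ge0 law_xi mF Fi).
rewrite integral_pos_support//; congr (_%:E).
rewrite (half_line_eq_integral FE) RintegralZl//.
by rewrite (integral_power_rotation ac0 bc0 ltr01 sbc)// divr1.
Qed.

End gig_moments.

Section normal_moments.
Context d (T : measurableType d) (R : realType) (P : probability T R).
Notation mu := (@lebesgue_measure R).
Local Notation pos := (`]0%R, +oo[%classic : set R).
Variables (eta : {RV P >-> R}) (m sigma : R).
Hypothesis sigma0 : 0 < sigma.
Hypothesis law_eta : has_law P eta (normal_prob m sigma).

Let s2_gt0 : 0 < sigma ^+ 2. Proof. by rewrite exprn_gt0. Qed.
Let s2_neq0 : sigma ^+ 2 != 0. Proof. exact: lt0r_neq0. Qed.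
Let sigma_neq0 : sigma != 0. Proof. exact: lt0r_neq0. Qed.

Let pdfE x : normal_pdf m sigma x =
  normal_peak sigma * expR (- ((x - m) ^+ 2 / (2 * sigma ^+ 2))).
Proof.
rewrite normal_pdfE// /normal_fun; congr (_ * expR _).
by field.
Qed.

Let law_pdf : has_law P eta
  (fun A => \int[mu]_(x in A) (normal_pdf m sigma x)%:E)%E.
Proof. exact: law_eta. Qed.

Let mpdf := measurable_normal_pdf m sigma.
Let pdf_ge0 := normal_pdf_ge0 m sigma.

Let gaussian_half_line n c : 0 < c ->
  mu.-integrable pos (EFin \o (fun t => t ^+ n * expR (- (c * t ^+ 2)))).
Proof.
move=> c0; have n1 : 0 < n.+1%:R :> R by [].
have := @integrable_power_weight _ c 0 2 n.+1%:R c0 (lexx 0) (ltr0n _ 2)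
  (or_introl n1).
apply: half_line_eq_integrable => t t0.
rewrite mul0r addr0 powR_mulrn ?(ltW t0)//.
by rewrite -natr1 addrK powR_mulrn// ltW.
Qed.

Let measurable_expR_sqr (c : R) :
  measurable_fun [set: R] (fun x => expR (- (c * x ^+ 2))).
Proof.
apply: measurableT_comp => //; apply: measurableT_comp => //.
exact: measurable_funM.
Qed.

Let gaussian_line n c : 0 < c ->
  mu.-integrable [set: R]
    (EFin \o (fun t => `|t| ^+ n * expR (- (c * t ^+ 2)))).
Proof.
move=> c0; apply: integrable_even.
- apply: measurable_funM => //; apply: measurable_funX; exact: normr_measurable.
- by move=> x; rewrite mulr_ge0 ?exprn_ge0 ?expR_ge0.
- by move=> x; rewrite normrN sqrrN.
- apply: half_line_eq_integrable (gaussian_half_line n c0) => t t0.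
  by rewrite gtr0_norm.
Qed.

(** (x - m)^2 >= x^2 / 2 - m^2 reduces this to a centred Gaussian weight. *)
Let absn_integrable n : mu.-integrable [set: R]
  (EFin \o (fun x => `|x| ^+ n * normal_pdf m sigma x)).
Proof.
have c0 : 0 < (4 * sigma ^+ 2)^-1 by rewrite invr_gt0 mulr_gt0.
pose K := normal_peak sigma * expR (m ^+ 2 / (2 * sigma ^+ 2)).
have gi := integrableZl measurableT K (gaussian_line n c0).
apply: (le_integrable _ _ _ gi) => //.
  apply/measurable_EFinP/measurable_funM => //.
  by apply: measurable_funX; exact: normr_measurable.
move=> x _; have K0 : 0 <= K by rewrite mulr_ge0 ?normal_peak_ge0 ?expR_ge0.
rewrite /= lee_fin ger0_norm ?mulr_ge0 ?exprn_ge0//.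
rewrite (le_trans _ (ler_norm _))// mulrCA ler_wpM2l ?exprn_ge0// pdfE.
rewrite /K -[leRHS]mulrA ler_wpM2l ?normal_peak_ge0// -expRD ler_expR -subr_ge0.
rewrite (_ : _ - _ = (x - 2 * m) ^+ 2 / (4 * sigma ^+ 2)); last by field.
by rewrite divr_ge0 ?sqr_ge0// mulr_ge0// ltW.
Qed.

Variables (f : R -> R) (n : nat).
Hypothesis mf : measurable_fun [set: R] f.
Hypothesis f_norm : forall x, `|f x| = `|x| ^+ n.

Lemma normal_integrable : P.-integrable [set: T] (EFin \o (f \o eta)).
Proof.
apply: (law_density_integrable mpdf pdf_ge0 law_pdf mf).
apply: (le_integrable _ _ _ (absn_integrable n)) => //.
  exact/measurable_EFinP/measurable_funM.
by move=> x _; rewrite lee_fin !normrM f_norm normrX normr_id.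
Qed.

(** The quotient of exp(-x^2/sigma^2) by the normal density, scaled so as not to
    exceed 1.  It replaces the density of eta by a centred weight, whatever m;
    the rate 1/sigma^2, twice that of the density, is what keeps it bounded. *)
Definition normal_tilt (x : R) : R :=
  expR (- (x ^+ 2 / sigma ^+ 2) + (x - m) ^+ 2 / (2 * sigma ^+ 2)
        - m ^+ 2 / sigma ^+ 2).

Lemma normal_tilt_ge0 x : 0 <= normal_tilt x.
Proof. exact: expR_ge0. Qed.

Lemma normal_tilt_le1 x : normal_tilt x <= 1.
Proof.
rewrite /normal_tilt -[leRHS]expR0 ler_expR.
rewrite [leLHS](_ : _ = - ((x + m) ^+ 2 / (2 * sigma ^+ 2))); last by field.
by rewrite oppr_le0 divr_ge0 ?sqr_ge0// mulr_ge0// ltW.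
Qed.

Lemma measurable_normal_tilt : measurable_fun [set: R] normal_tilt.
Proof.
apply: measurableT_comp => //; apply: measurable_funB => //.
apply: measurable_funD.
  by apply: measurableT_comp => //; apply: measurable_funM.
apply: measurable_funM => //; apply: measurable_funX.
exact: measurable_funB.
Qed.

Variable ep : R.
Hypothesis fE : forall t, 0 < t -> f t = t ^+ n.
Hypothesis fNE : forall t, 0 < t -> f (- t) = ep * t ^+ n.

(** Folding the line at 0 leaves the half-line weight of exponent n + 1 with
    p = 2, whose rotation has the phase (n + 1) th / 2.  The factor 1 + ep
    vanishes for an odd function f. *)
Lemma normal_oscillating_moment (de th : R) : 0 <= th < pi / 2 ->
  (\int[P]_w (f (eta w) * (normal_tilt (eta w) *
     cos (de - tan th * (eta w ^+ 2 / sigma ^+ 2))))%:E =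
   (normal_peak sigma * expR (- (m ^+ 2 / sigma ^+ 2)) * (1 + ep) *
    (cos (de - n.+1%:R / 2 * th) * \int[mu]_(t in pos)
     (t `^ (n.+1%:R - 1) *
      expR (- ((sigma ^+ 2)^-1 / cos th * t `^ 2 + 0 * t `^ (- 2))))))%:E)%E.
Proof.
move=> th_itv.
have cth : 0 < cos th by exact: cos_gt0_acute.
pose K := normal_peak sigma * expR (- (m ^+ 2 / sigma ^+ 2)).
pose G x := expR (- (x ^+ 2 / sigma ^+ 2)) *
  cos (de - tan th * (x ^+ 2 / sigma ^+ 2)).
pose F x := f x * (normal_tilt x * cos (de - tan th * (x ^+ 2 / sigma ^+ 2))).
have FE x : F x * normal_pdf m sigma x = K * (f x * G x).
  rewrite /F /G pdfE /K.
  have -> : expR (- (x ^+ 2 / sigma ^+ 2)) = expR (m ^+ 2 / sigma ^+ 2) *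
      (normal_tilt x * expR (- ((x - m) ^+ 2 / (2 * sigma ^+ 2)))).
    by rewrite -!expRD; congr expR; ring.
  rewrite (expRN (m ^+ 2 / sigma ^+ 2)); field.
  by rewrite gt_eqF ?expR_gt0.
have mcos : measurable_fun [set: R]
    (fun x => cos (de - tan th * (x ^+ 2 / sigma ^+ 2))).
  apply: (measurableT_comp (@measurable_cos R)).
  apply: measurable_funB => //; apply: measurable_funM => //.
  exact: measurable_funM.
have mF : measurable_fun [set: R] F.
  apply: measurable_funM => //; apply: measurable_funM => //.
  exact: measurable_normal_tilt.
have Fi : mu.-integrable [set: R]
    (EFin \o (fun x => F x * normal_pdf m sigma x)).
  apply: (le_integrable _ _ _ (absn_integrable n)) => //.
    exact/measurable_EFinP/measurable_funM.
  move=> x _; rewrite lee_fin !normrM f_norm normrX normr_id.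
  rewrite ler_wpM2r// ler_piMr ?exprn_ge0//.
  rewrite (ger0_norm (normal_tilt_ge0 x)).
  rewrite mulr_ile1 ?normal_tilt_ge0 ?normal_tilt_le1//.
  exact: cos_max.
rewrite (law_density_integral mpdf pdf_ge0 law_pdf mF Fi) integral_fold//.
congr (_%:E).
have c0 : 0 < (sigma ^+ 2)^-1 / cos th by rewrite divr_gt0// invr_gt0.
have n1 : 0 < n.+1%:R :> R by [].
have := @integral_power_rotation _ _ _ 2 n.+1%:R c0 (lexx 0) (ltr0n _ 2)
  (or_introl n1) de _ th_itv.
have Wi := @integrable_power_rotation _ _ _ 2 n.+1%:R c0 (lexx 0) (ltr0n _ 2)
  (or_introl n1) de _ cth.
move=> <-; rewrite -RintegralZl//; apply: half_line_eq_integral => t t0.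
rewrite !FE fE// fNE// /G sqrrN.
rewrite mul0r addr0 subr0 powR_mulrn ?(ltW t0)//.
rewrite -natr1 addrK powR_mulrn ?(ltW t0)//.
have -> : cos th * ((sigma ^+ 2)^-1 / cos th * t ^+ 2) = t ^+ 2 / sigma ^+ 2.
  by field; rewrite sigma_neq0 lt0r_neq0.
have -> : sin th * ((sigma ^+ 2)^-1 / cos th * t ^+ 2) =
    tan th * (t ^+ 2 / sigma ^+ 2).
  by rewrite /tan; field; rewrite sigma_neq0 lt0r_neq0.
by rewrite /K; ring.
Qed.

End normal_moments.

(** * The product of a generalized inverse Gaussian and a normal variable *)

(** The two reasons for a moment to vanish: the first factor is 0 when n is odd,
    the second one when n is even. *)
Lemma parity_sin_pihalf_eq0 (R : realType) (n : nat) :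
  (1 + (-1) ^+ n) * sin (n%:R / 2 * pi) = 0 :> R.
Proof.
rewrite -signr_odd; case: (boolP (odd n)) => [_|/even_halfK <-].
  by rewrite expr1 addrN mul0r.
rewrite (_ : _ / 2 * pi = n./2%:R * pi); last by rewrite -muln2 natrM; field.
elim: n./2 => [|k IHk]; first by rewrite mul0r sin0 mulr0.
by rewrite -[k.+1%:R]natr1 [(_ + 1) * pi]mulrDl mul1r sinDpi mulrN IHk oppr0.
Qed.

Section gig_normal_product.
Context d (T : measurableType d) (R : realType) (P : probability T R).
Notation mu := (@lebesgue_measure R).
Local Notation pos := (`]0%R, +oo[%classic : set R).
Variables (xi eta : {RV P >-> R}) (s a b C m sigma : R).
Hypotheses (a0 : 0 < a) (b0 : 0 <= b) (sb : 0 < s \/ 0 < b) (C0 : 0 < C).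
Hypothesis sigma0 : 0 < sigma.
Hypothesis xi_eta : independent_RV P xi eta.
Hypothesis law_xi : has_law P xi
  (fun A => \int[mu]_(x in A) (gig_pdf s a b C x)%:E)%E.
Hypothesis law_eta : has_law P eta (normal_prob m sigma).

(* The phase of the moment of order n is -(s + n) th - (n + 1) th / 2.  With
   this th it decreases by pi / 2 from one order to the next, and with this ph0
   it is brought to pi / 2 for n = 0. *)
Let th : R := pi / 3.
Let ph0 : R := (s + 1 / 2) * th + pi / 2.

Let th_itv : 0 <= th < pi / 2.
Proof. by have := pi_gt0 R; rewrite /th; lra. Qed.

Let cth : 0 < cos th.
Proof. exact: cos_gt0_acute. Qed.

Let wave_xi (de x : R) := cos (de - tan th * (a * x `^ 1 - b * x `^ (- 1))).
Let wave_eta (de y : R) :=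
  normal_tilt m sigma y * cos (de - tan th * (y ^+ 2 / sigma ^+ 2)).

Let h (w : T) : R := normal_tilt m sigma (eta w) *
  cos (ph0 - tan th * (a * xi w `^ 1 - b * xi w `^ (- 1))
           - tan th * (eta w ^+ 2 / sigma ^+ 2)).

(** The addition formula separates the variables, so that independence applies
    to both terms. *)
Let hE w : h w = wave_xi ph0 (xi w) * wave_eta 0 (eta w)
  + wave_xi (ph0 - pi / 2) (xi w) * wave_eta (pi / 2) (eta w).
Proof.
rewrite /h /wave_xi /wave_eta.
set t := tan th * (_ - _); set o := tan th * (_ / _).
rewrite [ph0 - pi / 2 - t]addrAC cosBpihalf sub0r cosN.
by rewrite (cosB (ph0 - t)) (cosB (pi / 2)) cos_pihalf sin_pihalf; ring.
Qed.

Let mwave_xi de : measurable_fun [set: R] (wave_xi de).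
Proof.
apply: (measurableT_comp (@measurable_cos R)).
apply: measurable_funB => //; apply: measurable_funM => //.
by apply: measurable_funB; apply: measurable_funM.
Qed.

Let mwave_eta de : measurable_fun [set: R] (wave_eta de).
Proof.
apply: measurable_funM; first exact: measurable_normal_tilt.
apply: (measurableT_comp (@measurable_cos R)).
apply: measurable_funB => //; apply: measurable_funM => //.
exact: measurable_funM.
Qed.

Let wave_xi_le1 de x : `|wave_xi de x| <= 1.
Proof. exact: cos_max. Qed.

Let tilt_norm_le1 y (c : R) : `|normal_tilt m sigma y * cos c| <= 1.
Proof.
have t0 := normal_tilt_ge0 m sigma y.
rewrite normrM (ger0_norm t0) mulr_ile1 ?cos_max//.
exact: (normal_tilt_le1 m sigma0).
Qed.

Let wave_eta_le1 de y : `|wave_eta de y| <= 1.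
Proof. exact: tilt_norm_le1. Qed.

Let h_le1 w : `|h w| <= 1.
Proof. exact: tilt_norm_le1. Qed.

Let mxi : measurable_fun [set: T] xi. Proof. exact: measurable_funPT. Qed.
Let meta : measurable_fun [set: T] eta. Proof. exact: measurable_funPT. Qed.

Let mh : measurable_fun [set: T] h.
Proof.
rewrite (funext hE); apply: measurable_funD; apply: measurable_funM.
- exact: measurableT_comp (mwave_xi _) mxi.
- exact: measurableT_comp (mwave_eta _) meta.
- exact: measurableT_comp (mwave_xi _) mxi.
- exact: measurableT_comp (mwave_eta _) meta.
Qed.

Let U n := \int[mu]_(t in pos) (t `^ (s + n%:R - 1) *
  expR (- (a / cos th * t `^ 1 + b / cos th * t `^ (- 1)))).
Let V n := \int[mu]_(t in pos) (t `^ (n.+1%:R - 1) *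
  expR (- ((sigma ^+ 2)^-1 / cos th * t `^ 2 + 0 * t `^ (- 2)))).
Let K := normal_peak sigma * expR (- (m ^+ 2 / sigma ^+ 2)).

Let U_gt0 n : 0 < U n.
Proof.
apply: integral_power_weight_gt0 => //; first by rewrite divr_gt0.
- by rewrite divr_ge0// ltW.
- by case: sb => [s0|b_gt0]; [left; rewrite ltr_wpDr|right; rewrite divr_gt0].
Qed.

Let V_gt0 n : 0 < V n.
Proof.
apply: integral_power_weight_gt0 => //; last by left.
by rewrite divr_gt0// invr_gt0 exprn_gt0.
Qed.

(** The functions f and g stand for powers or absolute powers of order n; the
    parity of g is recorded by ep. *)
Section mixed_moment.
Variables (f g : R -> R) (n : nat) (ep : R).
Hypotheses (mf : measurable_fun [set: R] f) (mg : measurable_fun [set: R] g).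
Hypothesis fE : forall t, 0 < t -> f t = t ^+ n.
Hypothesis gE : forall t, 0 < t -> g t = t ^+ n.
Hypothesis gNE : forall t, 0 < t -> g (- t) = ep * t ^+ n.
Hypothesis g_norm : forall x, `|g x| = `|x| ^+ n.

Let fi : P.-integrable [set: T] (EFin \o (f \o xi)).
Proof. exact: (gig_integrable a0 b0 sb C0 law_xi mf fE). Qed.

Let gi : P.-integrable [set: T] (EFin \o (g \o eta)).
Proof. exact: (normal_integrable sigma0 law_eta mg g_norm). Qed.

Let mfw de : measurable_fun [set: R] (fun x => f x * wave_xi de x).
Proof. exact: measurable_funM. Qed.

Let mgw de : measurable_fun [set: R] (fun x => g x * wave_eta de x).
Proof. exact: measurable_funM. Qed.

Let fwi de : P.-integrable [set: T]
  (EFin \o ((fun x => f x * wave_xi de x) \o xi)).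
Proof.
exact: (integrable_mul_le1 (measurableT_comp (mwave_xi de) mxi)
  (fun w => wave_xi_le1 de (xi w)) fi).
Qed.

Let gwi de : P.-integrable [set: T]
  (EFin \o ((fun x => g x * wave_eta de x) \o eta)).
Proof.
exact: (integrable_mul_le1 (measurableT_comp (mwave_eta de) meta)
  (fun w => wave_eta_le1 de (eta w)) gi).
Qed.

Let wave_product de de' :
  (\int[P]_w
     (f (xi w) * wave_xi de (xi w) * (g (eta w) * wave_eta de' (eta w)))%:E
   = (C * U n * (K * (1 + ep)) * V n *
      (cos (de - (s + n%:R) * th) * cos (de' - n.+1%:R / 2 * th)))%:E)%E.
Proof.
rewrite (independent_integralM xi_eta (mfw de) (mgw de') (fwi de) (gwi de')).
rewrite (gig_oscillating_moment a0 b0 sb C0 law_xi mf fE de th_itv).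
rewrite (normal_oscillating_moment sigma0 law_eta mg g_norm gE gNE de' th_itv).
rewrite -EFinM -/(U n) -/(V n) -/K; congr (_%:E); ring.
Qed.

Let wave_integrable de de' : P.-integrable [set: T]
  (fun w =>
     (f (xi w) * wave_xi de (xi w) * (g (eta w) * wave_eta de' (eta w)))%:E).
Proof.
exact: (independent_integrableM xi_eta (mfw de) (mgw de') (fwi de) (gwi de')).
Qed.

(** The two separated terms recombine into the cosine of
    ph0 - (s + n) th - (n + 1) th / 2, which equals pi / 2 - n pi / 2. *)
Lemma mixed_moment_perturbation :
  (\int[P]_w (f (xi w) * g (eta w) * h w)%:E
   = (C * U n * (K * (1 + ep)) * V n * sin (n%:R / 2 * pi))%:E)%E.
Proof.
transitivity (\int[P]_w
   ((f (xi w) * wave_xi ph0 (xi w) * (g (eta w) * wave_eta 0 (eta w)))%:E +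
    (f (xi w) * wave_xi (ph0 - pi / 2) (xi w) *
       (g (eta w) * wave_eta (pi / 2) (eta w)))%:E))%E.
  by apply: eq_integral => w _; rewrite hE -EFinD; congr (_%:E); ring.
rewrite integralD// !wave_product -EFinD; congr (_%:E).
rewrite -mulrDr; congr (_ * _).
rewrite sub0r cosN [ph0 - _ - _]addrAC cosBpihalf.
have -> : cos (pi / 2 - n.+1%:R / 2 * th) = sin (n.+1%:R / 2 * th).
  by rewrite -cosN opprB cosBpihalf.
rewrite -cosB (_ : _ - _ = - (n%:R / 2 * pi - pi / 2)).
  by rewrite cosN cosBpihalf.
by rewrite /ph0 /th -natr1; field.
Qed.

Lemma mixed_moment_integrable :
  P.-integrable [set: T] (fun w => (f (xi w) * g (eta w))%:E).
Proof. exact: (independent_integrableM xi_eta mf mg fi gi). Qed.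

End mixed_moment.

Theorem gig_normal_M_indet : M_indet P (xi * eta).
Proof.
have mX k : measurable_fun [set: R] (fun x : R => x ^+ k).
  exact: measurable_funX.
have mabs : measurable_fun [set: R] (fun x : R => `|x|).
  exact: normr_measurable.
apply: (perturbation_M_indet mh h_le1).
- move=> k.
  have := mixed_moment_integrable (n := k) (mX k) (mX k) (fun t _ => erefl)
    (fun x => normrX k x).
  by apply: eq_integrable => // w _; rewrite /= exprMn.
- move=> k.
  have Nk (t : R) : 0 < t -> (- t) ^+ k = (-1) ^+ k * t ^+ k.
    by move=> _; exact: exprNn.
  transitivity (\int[P]_w (xi w ^+ k * eta w ^+ k * h w)%:E)%E.
    by apply: eq_integral => w _; rewrite /= exprMn.
  rewrite (mixed_moment_perturbation (mX k) (mX k) (fun t _ => erefl)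
    (fun t _ => erefl) Nk (fun x => normrX k x)); congr (_%:E).
  have := parity_sin_pihalf_eq0 R k.
  set e := 1 + _; set si := sin _ => esi.
  rewrite (_ : _ * si = C * U k * K * V k * (e * si)); last by ring.
  by rewrite esi mulr0.
- have abs1 (t : R) : 0 < t -> `|t| = t ^+ 1 by move=> t0; rewrite gtr0_norm.
  have absN (t : R) : 0 < t -> `|- t| = 1 * t ^+ 1.
    by move=> t0; rewrite normrN gtr0_norm// mul1r.
  have abs_norm (x : R) : `| `|x| | = `|x| ^+ 1 by rewrite normr_id.
  have sin1 : sin (1%:R / 2 * pi) = 1 :> R.
    by rewrite (_ : _ * pi = pi / 2) ?sin_pihalf//; field.
  have -> : (\int[P]_w (`|(xi * eta) w| * h w)%:E)%E =
      (C * U 1 * (K * (1 + 1)) * V 1)%:E.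
    transitivity (\int[P]_w (`|xi w| * `|eta w| * h w)%:E)%E.
      by apply: eq_integral => w _; rewrite /= normrM.
    rewrite (mixed_moment_perturbation mabs mabs abs1 abs1 absN abs_norm).
    by rewrite sin1; congr (_%:E); exact: mulr1.
  have K0 : 0 < K by rewrite mulr_gt0 ?expR_gt0// normal_peak_gt0// lt0r_neq0.
  have two0 : 0 < 1 + 1 :> R by [].
  have := mulr_gt0
    (mulr_gt0 (mulr_gt0 C0 (U_gt0 1)) (mulr_gt0 K0 two0)) (V_gt0 1).
  by move: (C * _ * _ * _) => x x0; rewrite gt_eqF// lte_fin.
Qed.

End gig_normal_product.

(** * The two special cases *)

Lemma Gamma_gt0 (R : realType) (al : R) : 0 < al -> 0 < Gamma al.
Proof.
move=> al0; rewrite /Gamma.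
have := @integral_power_weight_gt0 R 1 0 1 al ltr01 (lexx 0) ltr01
  (or_introl al0).
rewrite (@half_line_eq_integral _ _ (fun t => t `^ (al - 1) * expR (- t)))//.
move=> t t0.
by rewrite mul0r addr0 mul1r powRr1// ltW.
Qed.

Lemma chi_square_pdf_gig (R : realType) (k : nat) (x : R) :
  chi_square_pdf k x =
  gig_pdf (k%:R / 2) (1 / 2) 0 (2 `^ (k%:R / 2) * Gamma (k%:R / 2))^-1 x.
Proof.
rewrite /chi_square_pdf /gig_pdf; case: ifP => // x0.
rewrite mul0r addr0 powRr1 ?(ltW x0)// mulrC; congr (_ * (_ * expR _)).
by field.
Qed.

(** Expanding (x - mu)^2 / (2 mu^2 x) yields x / (2 mu^2) + 1 / (2 x) and the
    constant -1 / mu, which goes into the normalization. *)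
Lemma inverse_gaussian_pdf_gig (R : realType) (mu lambda x : R) :
  0 < mu -> 0 < lambda ->
  inverse_gaussian_pdf mu lambda x =
  gig_pdf (- (1 / 2)) (lambda / (2 * mu ^+ 2)) (lambda / 2)
    (Num.sqrt (lambda / (2 * pi)) * expR (lambda / mu)) x.
Proof.
move=> mu0 la0; rewrite /inverse_gaussian_pdf /gig_pdf; case: ifP => // x0.
have x_ge0 := ltW x0; have pi0 := pi_gt0 R.
have la_pi : 0 <= lambda / (2 * pi) by rewrite divr_ge0// ?mulr_ge0// ltW.
rewrite (_ : lambda / (2 * pi * x ^+ 3) =
    lambda / (2 * pi) * x `^ (- 3%:R)); last first.
  by rewrite powR_invn// invfM mulrA.
rewrite sqrtrM// -[Num.sqrt (x `^ _)]powR12_sqrt ?powR_ge0// -powRrM.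
rewrite (_ : - 3%:R * 2^-1 = - (1 / 2) - 1); last by field.
rewrite powRr1// powR_inv1//.
rewrite -!mulrA; congr (_ * _); rewrite [RHS]mulrCA; congr (_ * _).
rewrite -expRD; congr expR; field.
by rewrite !lt0r_neq0.
Qed.

Theorem corollary5 (R : realType) (d : measure_display) (T : measurableType d)
    (P : probability T R) (xi eta : {RV P >-> R}) :
  (forall (k : nat) (m sigma : R), (0 < k)%N -> 0 < sigma ->
     independent_RV P xi eta ->
     has_law P xi (chi_square_prob k) ->
     has_law P eta (normal_prob m sigma) ->
     M_indet P (xi * eta)) /\
  (forall mu lambda m sigma : R, 0 < mu -> 0 < lambda -> 0 < sigma ->
     independent_RV P xi eta ->
     has_law P xi (inverse_gaussian_prob mu lambda) ->
     has_law P eta (normal_prob m sigma) ->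
     M_indet P (xi * eta)).
Proof.
split=> [k m sigma k0 sigma0 ind law_xi law_eta|
         mu lambda m sigma mu0 la0 sigma0 ind law_xi law_eta].
- have k20 : 0 < k%:R / 2 :> R by rewrite divr_gt0// ltr0n.
  apply: (@gig_normal_M_indet _ _ _ _ _ _ (k%:R / 2) (1 / 2) 0
    (2 `^ (k%:R / 2) * Gamma (k%:R / 2))^-1 m sigma) => //.
  + by left.
  + by rewrite invr_gt0 mulr_gt0 ?powR_gt0 ?Gamma_gt0.
  + move=> A mA; rewrite law_xi// /chi_square_prob.
    by under eq_integral do rewrite chi_square_pdf_gig.
- have b_gt0 : 0 < lambda / 2 by rewrite divr_gt0.
  apply: (@gig_normal_M_indet _ _ _ _ _ _ (- (1 / 2)) (lambda / (2 * mu ^+ 2))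
    (lambda / 2) (Num.sqrt (lambda / (2 * pi)) * expR (lambda / mu))
    m sigma) => //.
  + by rewrite divr_gt0// mulr_gt0// exprn_gt0.
  + exact: ltW.
  + by right.
  + have pi0 := pi_gt0 R; apply: mulr_gt0; last exact: expR_gt0.
    by rewrite sqrtr_gt0 divr_gt0// mulr_gt0.
  + move=> A mA; rewrite law_xi// /inverse_gaussian_prob.
    by under eq_integral do rewrite (inverse_gaussian_pdf_gig _ mu0 la0).
Qed.
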